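(* Let $R$ be an order in $K$ and let $\mathfrak p$ be a maximal ideal of $R$ which is the unique non-invertible maximal ideal of $R$. Let $k=R/\mathfrak p$, let $T=(\mathfrak p:\mathfrak p)$, put $T_{\mathfrak p}=T\otimes_R R_{\mathfrak p}$, and let $A=T/\mathfrak p$ (a $k$-algebra, with $k=R/\mathfrak p\subseteq A$). Let $J_1,\ldots,J_n$ be fractional $T$-ideals with $(J_i:J_i)=T$ that represent the distinct classes of $\bar W(T)$. For each $i=1,\dots,n$, let $\mathcal V_i$ be the set of sub-$k$-vector spaces $\mathcal I$ of $J_i/\mathfrak pJ_i$ satisfying \[\{a\in A: a\mathcal I\subseteq \mathcal I\}=k\quad\text{and}\quad \mathcal I A=J_i/\mathfrak pJ_i.\] Let $U=T_{\mathfrak p}^\times/R_{\mathfrak p}^\times$, acting on $\mathcal V_i$ as follows: for $u\in T_{\mathfrak p}^\times$ let $L_u$ be the unique fractional $R$-ideal with $(L_u)_{\mathfrak p}=uR_{\mathfrak p}$ and $(L_u)_{\mathfrak q}=R_{\mathfrak q}$ for all maximal ideals $\mathfrak q\neq\mathfrak p$; for $\mathcal I=I/\mathfrak pJ_i\in\mathcal V_i$ (with $\mathfrak pJ_i\subseteq I\subseteq J_i$ a fractional $R$-ideal) set $u\cdot\mathcal I=L_uI/\mathfrak pJ_i$. Then this is a well-defined free action of $U$ on each $\mathcal V_i$, and there is a bijection \[\bar W(R)\longleftrightarrow \bigsqcup_{i=1}^n \mathcal V_i/U.\]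
   Context: Let $Z$ be a Dedekind domain (in particular not a field) with fraction field $Q$, and let $K$ be an étale $Q$-algebra (a finite product of finite separable field extensions of $Q$). A $Z$-lattice in $K$ is a finitely generated $Z$-submodule of $K$ containing a $Q$-basis of $K$. An order is a subring of $K$ that is a $Z$-lattice; an overorder of an order $R$ is an order containing $R$. A fractional $R$-ideal is an $R$-submodule of $K$ that is a $Z$-lattice. For $Z$-lattices $I,J$ write $(I:J)=\{a\in K: aJ\subseteq I\}$; $(I:I)$ is the multiplicator ring of $I$. A fractional $R$-ideal $I$ is invertible if $I(R:I)=R$. For a maximal ideal $\mathfrak p$ of $R$, $R_{\mathfrak p}$ denotes the completion of $R$ at $\mathfrak p$ and, for a fractional $R$-ideal $I$, $I_{\mathfrak p}=I\otimes_R R_{\mathfrak p}$, viewed inside the total ring of quotients of $R_{\mathfrak p}$. Two fractional $S$-ideals $I,J$ (for an order $S$) are weakly equivalent if $I_{\mathfrak q}\simeq J_{\mathfrak q}$ as $S_{\mathfrak q}$-modules for every maximal ideal $\mathfrak q$ of $S$. $\bar W(S)$ denotes the set of weak equivalence classes of fractional $S$-ideals $I$ with $(I:I)=S$. *)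

(* Defs.v *)
(* Mathematical Components, with classical sets from MathComp-Analysis. *)
From HB Require Import structures.
From mathcomp Require Import all_boot all_order all_algebra all_field.
From mathcomp Require Import generic_quotient ring.
From mathcomp Require Import boolp classical_sets functions.

Set Implicit Arguments.
Unset Strict Implicit.
Unset Printing Implicit Defensive.

Import GRing.Theory.
Local Open Scope ring_scope.
Local Open Scope classical_set_scope.

Section Sets.
Variable A : comPzRingType.
Implicit Types (M N I J R : set A) (C D : set A).

Definition prods M N : set A :=
  [set x | exists s : seq (A * A),
     (forall e, e \in s -> M e.1 /\ N e.2) /\ x = \sum_(e <- s) e.1 * e.2].

Definition colon I J : set A := [set a | forall x, J x -> I (a * x)].

Definition unitsof R : set A := [set u | R u /\ exists v, R v /\ u * v = 1].

Definition regular (s : A) := forall x : A, s * x = 0 -> x = 0.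

Record subring := Subring {
  subring_set :> set A;
  subringP : [/\ subring_set 1,
    (forall x y, subring_set x -> subring_set y -> subring_set (x - y)) &
    (forall x y, subring_set x -> subring_set y -> subring_set (x * y))] }.

Definition submodule R I :=
  [/\ I 0, (forall x y, I x -> I y -> I (x + y)) &
      (forall r x, R r -> I x -> I (r * x))].

Definition is_ideal R I := submodule R I /\ I `<=` R.

Definition prime_ideal R P :=
  [/\ is_ideal R P, ~ P 1 &
      forall x y, R x -> R y -> P (x * y) -> P x \/ P y].

Definition maximal_ideal R M :=
  [/\ is_ideal R M, M <> R &
      forall I, is_ideal R I -> M `<=` I -> I = M \/ I = R].

(* Quotients M / N of additive subgroups, and the operations induced on them,
   are represented by sets of cosets: [resq M N] is M / N. *)
Definition rescl N x : set A := [set y | N (y - x)].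
Definition resq M N : set (set A) := [set rescl N x | x in M].
Definition resadd N C D : set A :=
  [set z | exists x y, [/\ C x, D y & N (z - (x + y))]].
(* C may be a coset of another subgroup N', provided N' * D is contained in N;
   this covers the action of R/I on M/IM. *)
Definition resmul N C D : set A :=
  [set z | exists x y, [/\ C x, D y & N (z - x * y)]].
Definition resspan N (W B : set (set A)) : set (set A) :=
  [set C | exists s : seq (set A * set A),
     (forall e, e \in s -> W e.1 /\ B e.2) /\
     C = \big[resadd N / rescl N 0]_(e <- s) resmul N e.1 e.2].

End Sets.

Section SubringType.
Variables (A : comPzRingType) (R : subring A).

Record sring := Sring { sring_val :> A; sring_valP : sring_val \in (R : set A) }.
HB.instance Definition _ := [isSub for sring_val].
HB.instance Definition _ := [Choice of sring by <:].

Fact sring_closed : subring_closed (fun x : A => x \in (R : set A)).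
Proof.
have [h1 hB hM] := subringP R; split.
- exact/mem_set.
- by move=> x y /set_mem hx /set_mem hy; apply/mem_set/hB.
- by move=> x y /set_mem hx /set_mem hy; apply/mem_set/hM.
Qed.
HB.instance Definition _ :=
  GRing.SubChoice_isSubComPzRing.Build A _ sring sring_closed.
End SubringType.

Section Completion.
Variables (A : comPzRingType) (I : set A).

Fixpoint idpow n : set A := if n is n'.+1 then prods I (idpow n') else setT.

Fact idpow0 n : idpow n 0.
Proof. by case: n => //= n; exists [::]; split=> //; rewrite big_nil. Qed.

Fact idpowD n x y : idpow n x -> idpow n y -> idpow n (x + y).
Proof.
case: n => //= n [s [hs ->]] [t [ht ->]]; exists (s ++ t).
rewrite big_cat; split=> // e; rewrite mem_cat => /orP[/hs|/ht] //.
Qed.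

Fact idpowM n a x : idpow n x -> idpow n (a * x).
Proof.
elim: n a x => //= n IHn a x [s [hs ->]].
exists [seq (e.1, a * e.2) | e <- s]; split=> [e /mapP[f /hs[h1 h2] ->]|].
  by split=> //=; apply: IHn.
rewrite big_map mulr_sumr; apply: eq_bigr => e _ /=; exact: mulrCA.
Qed.

Fact idpowN n x : idpow n x -> idpow n (- x).
Proof. by move=> hx; rewrite -mulN1r; apply: idpowM. Qed.

Fact idpowS n : idpow n.+1 `<=` idpow n.
Proof.
elim: n => // n IHn x [s [hs ->]]; exists s; split=> // e /hs[h1 h2].
by split=> //; apply: IHn.
Qed.

(* The inverse limit of the rings A / I^n, an element of A / I^n being a coset
   of I^n. *)
Record completion := Completion {
  comp_proj :> nat -> set A;
  comp_projP : forall n, resq setT (idpow n) (comp_proj n) /\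
                         comp_proj n.+1 `<=` comp_proj n }.

Implicit Types x y z : completion.

Lemma completion_eq x y : (forall n, x n = y n) -> x = y.
Proof.
case: x y => [x px] [y py] /= /funext exy; rewrite exy in px *.
by congr Completion; apply: Prop_irrelevance.
Qed.

HB.instance Definition _ := gen_eqMixin completion.
HB.instance Definition _ := gen_choiceMixin completion.

Lemma resclP n a b : rescl (idpow n) a b <-> rescl (idpow n) a = rescl (idpow n) b.
Proof.
split=> [h|->]; last by rewrite /rescl /= subrr; apply: idpow0.
rewrite eqEsubset; split=> c hc; rewrite /rescl /= in h hc *.
  by rewrite -(subrKA a) -[X in _ + X]opprB; apply: idpowD => //; apply: idpowN.
by rewrite -(subrKA b); apply: idpowD.
Qed.

Lemma resadd_cl n a b : resadd (idpow n) (rescl (idpow n) a) (rescl (idpow n) b)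
  = rescl (idpow n) (a + b).
Proof.
rewrite eqEsubset; split=> c.
  move=> [x [y [hx hy h]]]; rewrite /rescl /= in hx hy *.
  rewrite -(subrKA (x + y)); apply: idpowD => //.
  by rewrite opprD addrACA; apply: idpowD.
by exists a, b; split=> //; rewrite /rescl /= subrr; apply: idpow0.
Qed.

Lemma resmul_cl n a b : resmul (idpow n) (rescl (idpow n) a) (rescl (idpow n) b)
  = rescl (idpow n) (a * b).
Proof.
rewrite eqEsubset; split=> c.
  move=> [x [y [hx hy h]]]; rewrite /rescl /= in hx hy *.
  rewrite -(subrKA (x * y)); apply: idpowD => //.
  rewrite -(subrKA (x * b)) -mulrBr -mulrBl [(x - a) * b]mulrC.
  by apply: idpowD; apply: idpowM.
by exists a, b; split=> //; rewrite /rescl /= subrr; apply: idpow0.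
Qed.

Lemma completionP x n : exists2 a, x n = rescl (idpow n) a & 
  forall m, (m <= n)%N -> x m = rescl (idpow m) a.
Proof.
have [[a _ xa] _] := comp_projP x n; exists a => // m.
have xna : x n a by rewrite -xa; apply/resclP.
have sub k : (k <= n)%N -> x n `<=` x k.
  elim: n {a xa xna} => [|j IHj]; first by rewrite leqn0 => /eqP->.
  rewrite leq_eqVlt => /orP[/eqP->//|/IHj h].
  by apply: subset_trans h; case: (comp_projP x j).
move=> /sub/(_ a xna); have [[b _ <-] _] := comp_projP x m.
by move/resclP.
Qed.

Fact to_completion_subproof (a : A) n :
  resq setT (idpow n) (rescl (idpow n) a) /\
  rescl (idpow n.+1) a `<=` rescl (idpow n) a.
Proof. by split=> [|c /idpowS //]; exists a. Qed.
Definition to_completion (a : A) : completion :=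
  Completion (to_completion_subproof a).

Fact comp_add_subproof x y n :
  resq setT (idpow n) (resadd (idpow n) (x n) (y n)) /\
  resadd (idpow n.+1) (x n.+1) (y n.+1) `<=` resadd (idpow n) (x n) (y n).
Proof.
have [a -> ha] := completionP x n.+1; have [b -> hb] := completionP y n.+1.
rewrite ha ?hb // !resadd_cl; exact: (to_completion_subproof (a + b)).
Qed.
Definition comp_add x y : completion := Completion (comp_add_subproof x y).

Fact comp_mul_subproof x y n :
  resq setT (idpow n) (resmul (idpow n) (x n) (y n)) /\
  resmul (idpow n.+1) (x n.+1) (y n.+1) `<=` resmul (idpow n) (x n) (y n).
Proof.
have [a -> ha] := completionP x n.+1; have [b -> hb] := completionP y n.+1.
rewrite ha ?hb // !resmul_cl; exact: (to_completion_subproof (a * b)).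
Qed.
Definition comp_mul x y : completion := Completion (comp_mul_subproof x y).

Definition comp_opp x := comp_mul (to_completion (-1)) x.

Fact comp_addA : associative comp_add.
Proof.
move=> x y z; apply: completion_eq => n /=.
have [a -> _] := completionP x n; have [b -> _] := completionP y n.
by have [c -> _] := completionP z n; rewrite !resadd_cl addrA.
Qed.
Fact comp_addC : commutative comp_add.
Proof.
move=> x y; apply: completion_eq => n /=.
have [a -> _] := completionP x n; have [b -> _] := completionP y n.
by rewrite !resadd_cl addrC.
Qed.
Fact comp_add0 : left_id (to_completion 0) comp_add.
Proof.
move=> x; apply: completion_eq => n /=.
by have [a -> _] := completionP x n; rewrite !resadd_cl add0r.
Qed.
Fact comp_addN : left_inverse (to_completion 0) comp_opp comp_add.
Proof.
move=> x; apply: completion_eq => n /=.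
have [a -> _] := completionP x n.
by rewrite resmul_cl resadd_cl mulN1r addNr.
Qed.
HB.instance Definition _ :=
  GRing.isZmodule.Build completion comp_addA comp_addC comp_add0 comp_addN.

Fact comp_mulA : associative comp_mul.
Proof.
move=> x y z; apply: completion_eq => n /=.
have [a -> _] := completionP x n; have [b -> _] := completionP y n.
by have [c -> _] := completionP z n; rewrite !resmul_cl mulrA.
Qed.
Fact comp_mulC : commutative comp_mul.
Proof.
move=> x y; apply: completion_eq => n /=.
have [a -> _] := completionP x n; have [b -> _] := completionP y n.
by rewrite !resmul_cl mulrC.
Qed.
Fact comp_mul1 : left_id (to_completion 1) comp_mul.
Proof.
move=> x; apply: completion_eq => n /=.
by have [a -> _] := completionP x n; rewrite !resmul_cl mul1r.
Qed.
Fact comp_mulDl : left_distributive comp_mul comp_add.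
Proof.
move=> x y z; apply: completion_eq => n /=.
have [a -> _] := completionP x n; have [b -> _] := completionP y n.
have [c -> _] := completionP z n.
by rewrite resadd_cl !resmul_cl resadd_cl mulrDl.
Qed.
HB.instance Definition _ := GRing.Zmodule_isComPzRing.Build completion
  comp_mulA comp_mulC comp_mul1 comp_mulDl.

Fact to_completion_zmod : zmod_morphism to_completion.
Proof.
by move=> a b; apply: completion_eq => n /=; rewrite resmul_cl resadd_cl mulN1r.
Qed.
Fact to_completion_monoid : monoid_morphism to_completion.
Proof. by split=> // a b; apply: completion_eq => n /=; rewrite resmul_cl. Qed.
HB.instance Definition _ :=
  GRing.isZmodMorphism.Build A completion to_completion to_completion_zmod.
HB.instance Definition _ :=
  GRing.isMonoidMorphism.Build A completion to_completion to_completion_monoid.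

End Completion.

Section TotalQuotients.
Variable A : comPzRingType.
Local Open Scope quotient_scope.

Record ratio := Ratio { num : A; den : A; denP : regular den }.
HB.instance Definition _ := gen_eqMixin ratio.
HB.instance Definition _ := gen_choiceMixin ratio.
Implicit Types x y z : ratio.

Fact regular1 : regular (1 : A). Proof. by move=> a; rewrite mul1r. Qed.

Fact regularM (s t : A) : regular s -> regular t -> regular (s * t).
Proof. by move=> hs ht a; rewrite -mulrA => /hs/ht. Qed.

Lemma regularI (s a b : A) : regular s -> s * a = s * b -> a = b.
Proof.
by move=> hs /eqP; rewrite -subr_eq0 -mulrBr => /eqP/hs/eqP; rewrite subr_eq0 => /eqP.
Qed.

Definition eqratio x y := num x * den y == num y * den x.

Fact eqratio_refl : reflexive eqratio. Proof. by move=> x; apply/eqP. Qed.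
Fact eqratio_sym : symmetric eqratio.
Proof. by move=> x y; rewrite /eqratio eq_sym. Qed.
Fact eqratio_trans : transitive eqratio.
Proof.
move=> y x z /eqP xy /eqP yz; apply/eqP.
apply: (regularI (@denP y)).
transitivity (num x * den y * den z); first by ring.
rewrite xy; transitivity (num y * den z * den x); first by ring.
by rewrite yz; ring.
Qed.
Canonical eqratio_equiv := EquivRel eqratio eqratio_refl eqratio_sym eqratio_trans.

(* The total ring of quotients of A: fractions with a regular denominator. *)
Definition totq := {eq_quot eqratio}.
HB.instance Definition _ : EqQuotient _ eqratio totq := EqQuotient.on totq.
HB.instance Definition _ := Choice.on totq.

Definition to_totq (a : A) : totq := \pi_totq (Ratio a regular1).

Lemma totqP x y : reflect (num x * den y = num y * den x) (x == y %[mod totq]).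
Proof. by rewrite eqmodE; apply: eqP. Qed.

Lemma repr_totq x : let r := repr (\pi_totq x) in num r * den x = num x * den r.
Proof. by apply/totqP; rewrite reprK. Qed.

Definition addr_ratio x y :=
  @Ratio (num x * den y + num y * den x) _ (regularM (@denP x) (@denP y)).
Definition mulr_ratio x y :=
  @Ratio (num x * num y) _ (regularM (@denP x) (@denP y)).

Definition totq_add (a b : totq) : totq := \pi_totq (addr_ratio (repr a) (repr b)).
Definition totq_mul (a b : totq) : totq := \pi_totq (mulr_ratio (repr a) (repr b)).
Definition totq_opp (a : totq) : totq := totq_mul (to_totq (-1)) a.

Lemma totq_addE x y : totq_add (\pi_totq x) (\pi_totq y) = \pi_totq (addr_ratio x y).
Proof.
apply/eqP/totqP; move: (repr_totq x) (repr_totq y).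
move: (repr (\pi_totq x)) (repr (\pi_totq y)) => u v /= eu ev.
transitivity (num u * den x * (den v * den y) + num v * den y * (den u * den x)).
  by ring.
rewrite ev eu /=; ring.
Qed.

Lemma totq_mulE x y : totq_mul (\pi_totq x) (\pi_totq y) = \pi_totq (mulr_ratio x y).
Proof.
apply/eqP/totqP; move: (repr_totq x) (repr_totq y).
move: (repr (\pi_totq x)) (repr (\pi_totq y)) => u v /= eu ev.
transitivity ((num u * den x) * (num v * den y)); first by ring.
by rewrite ev eu; ring.
Qed.

Fact totq_addA : associative totq_add.
Proof.
elim/quotW=> x; elim/quotW=> y; elim/quotW=> z.
rewrite (totq_addE y z) (totq_addE x y) (totq_addE _ z) (totq_addE x).
by apply/eqP/totqP => /=; ring.
Qed.
Fact totq_addC : commutative totq_add.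
Proof.
elim/quotW=> x; elim/quotW=> y.
by rewrite !totq_addE; apply/eqP/totqP => /=; ring.
Qed.
Fact totq_add0 : left_id (to_totq 0) totq_add.
Proof.
by elim/quotW=> x; rewrite !totq_addE; apply/eqP/totqP => /=; ring.
Qed.
Fact totq_addN : left_inverse (to_totq 0) totq_opp totq_add.
Proof.
elim/quotW=> x; rewrite /totq_opp !totq_mulE !totq_addE.
by apply/eqP/totqP => /=; ring.
Qed.
HB.instance Definition _ :=
  GRing.isZmodule.Build totq totq_addA totq_addC totq_add0 totq_addN.

Fact totq_mulA : associative totq_mul.
Proof.
elim/quotW=> x; elim/quotW=> y; elim/quotW=> z.
rewrite (totq_mulE y z) (totq_mulE x y) (totq_mulE _ z) (totq_mulE x).
by apply/eqP/totqP => /=; ring.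
Qed.
Fact totq_mulC : commutative totq_mul.
Proof.
elim/quotW=> x; elim/quotW=> y.
by rewrite !totq_mulE; apply/eqP/totqP => /=; ring.
Qed.
Fact totq_mul1 : left_id (to_totq 1) totq_mul.
Proof.
by elim/quotW=> x; rewrite !totq_mulE; apply/eqP/totqP => /=; ring.
Qed.
Fact totq_mulDl : left_distributive totq_mul totq_add.
Proof.
elim/quotW=> x; elim/quotW=> y; elim/quotW=> z.
rewrite (totq_addE x y) !(totq_mulE _ z) (totq_addE (mulr_ratio x z)).
by apply/eqP/totqP => /=; ring.
Qed.
HB.instance Definition _ := GRing.Zmodule_isComPzRing.Build totq
  totq_mulA totq_mulC totq_mul1 totq_mulDl.

Fact to_totq_zmod : zmod_morphism to_totq.
Proof.
move=> a b; symmetry; transitivity (totq_add (to_totq a) (totq_opp (to_totq b))).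
  by [].
rewrite /totq_opp /to_totq totq_mulE totq_addE.
by apply/eqP/totqP => /=; ring.
Qed.
Fact to_totq_monoid : monoid_morphism to_totq.
Proof.
split=> // a b; symmetry; transitivity (totq_mul (to_totq a) (to_totq b)) => //.
by rewrite totq_mulE; apply/eqP/totqP => /=; ring.
Qed.
HB.instance Definition _ := GRing.isZmodMorphism.Build A totq to_totq to_totq_zmod.
HB.instance Definition _ :=
  GRing.isMonoidMorphism.Build A totq to_totq to_totq_monoid.

End TotalQuotients.

Section Lattices.
Variables (Z : idomainType) (Q : fieldType) (iota : {rmorphism Z -> Q}).

Definition fraction_field :=
  injective iota /\ forall q, exists a b, b != 0 /\ q = iota a / iota b.

(* Integral closedness is stated in Q, which is the fraction field of Z as soon as
   [fraction_field] holds. *)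
Definition dedekind_domain :=
  [/\ exists z : Z, z != 0 /\ z \isn't a GRing.unit,
      forall I : set Z, is_ideal setT I ->
        exists m (g : 'I_m -> Z),
          I = [set x | exists c : 'I_m -> Z, x = \sum_(i < m) c i * g i],
      forall q : Q, integralOver iota q -> exists z, q = iota z &
      forall P : set Z, prime_ideal setT P -> P <> [set 0] ->
        maximal_ideal setT P].

Variable K : comAlgType Q.

Definition etale_algebra :=
  exists (m : nat) (L : 'I_m -> fieldExtType Q)
         (pr : forall i, {lrmorphism K -> L i}),
    (forall i, separable 1 {:L i}) /\
    forall y : (forall i, L i), exists! x : K, forall i, pr i x = y i.

Definition Q_basis d (b : 'I_d -> K) :=
  forall x : K, exists! c : {ffun 'I_d -> Q}, x = \sum_(i < d) c i *: b i.

Definition lattice (M : set K) :=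
  (exists m (g : 'I_m -> K),
     M = [set x | exists c : 'I_m -> Z, x = \sum_(i < m) iota (c i) *: g i]) /\
  (exists d (b : 'I_d -> K), Q_basis b /\ forall i, M (b i)).

Definition is_order (R : subring K) := lattice R.

Definition fractional_ideal (R : subring K) (I : set K) :=
  submodule R I /\ lattice I.

Definition invertible (R : subring K) (I : set K) := prods I (colon R I) = R.

End Lattices.

Section Localization.
Variables (K : comPzRingType) (R : subring K) (p : set K).

Definition complete := completion [set x : sring R | p (sring_val x)].
Definition tot := totq complete.
(* R_p viewed inside Tot(R_p). *)
Definition ring_at : set tot := range (@to_totq complete).

(* The graph of the canonical map from K = Tot(R) to Tot(R_p), which sends a/b to
   the quotient of the images of a and b. *)
Definition canon (x : K) (y : tot) := exists a b : sring R,
  [/\ regular b, sring_val b * x = sring_val a &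
      to_totq (to_completion _ b) * y = to_totq (to_completion _ a)].

(* The tensor product of I and R_p, viewed inside Tot(R_p): the image of the
   canonical map sending x (x) r to r * x, i.e. the R_p-submodule generated by the
   image of I. The map is injective, R_p being flat over R when R is Noetherian. *)
Definition ideal_at (I : set K) : set tot :=
  prods ring_at [set y | exists2 x, I x & canon x y].

End Localization.

Arguments ring_at {K} R p.
Arguments ideal_at {K} R p I.

Section WeakEquivalence.
Variables (K : comPzRingType) (S : subring K).

Definition isomorphic_at (q I J : set K) :=
  exists f : tot S q -> tot S q,
    [/\ set_bij (ideal_at S q I) (ideal_at S q J) f,
        forall x y, ideal_at S q I x -> ideal_at S q I y -> f (x + y) = f x + f y &
        forall r x, ring_at S q r -> ideal_at S q I x -> f (r * x) = r * f x].

Definition weakly_equivalent (I J : set K) :=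
  forall q, maximal_ideal S q -> isomorphic_at q I J.

End WeakEquivalence.

Section Classification.
Variables (Z : idomainType) (Q : fieldType) (iota : {rmorphism Z -> Q}).
Variables (K : comAlgType Q).

Definition weak_class (S : subring K) (I : set K) : set (set K) :=
  [set I' | fractional_ideal iota S I' /\ weakly_equivalent S I I'].

Definition Wbar (S : subring K) : set (set (set K)) :=
  [set C | exists I, [/\ fractional_ideal iota S I, colon I I = S &
                         C = weak_class S I]].

Section Action.
Variables (R : subring K) (p : set K) (T : subring K) (J : set K).

Local Notation pJ := (prods p J).

(* The set V of sub-k-vector spaces W of J / pJ, with k = R / p and A = T / p. *)
Definition Vset : set (set (set K)) :=
  [set W | [/\ [/\ W `<=` resq J pJ, W (rescl pJ 0),
                   (forall C D, W C -> W D -> W (resadd pJ C D)) &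
                   (forall c C, resq R p c -> W C -> W (resmul pJ c C))],
               [set a | resq T p a /\ forall C, W C -> W (resmul pJ a C)]
                 = resq R p &
               resspan pJ W (resq T p) = resq J pJ]].

Definition Tp_units : set (tot R p) := unitsof (ideal_at R p T).
Definition Rp_units : set (tot R p) := unitsof (ring_at R p).

Definition is_Lu (u : tot R p) (L : set K) :=
  [/\ fractional_ideal iota R L,
      ideal_at R p L = [set u * x | x in ring_at R p] &
      forall q, maximal_ideal R q -> q <> p -> ideal_at R q L = ring_at R q].

(* W = I / pJ for the fractional R-ideal I with pJ <= I <= J. *)
Definition is_lift (W : set (set K)) (I : set K) :=
  [/\ fractional_ideal iota R I, pJ `<=` I, I `<=` J & W = resq I pJ].

Definition U_class (u : tot R p) : set (tot R p) := [set u * v | v in Rp_units].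
Definition U_group : set (set (tot R p)) := [set U_class u | u in Tp_units].
Definition U_mul (g h : set (tot R p)) : set (tot R p) :=
  [set z | exists x y, [/\ g x, h y & z = x * y]].

End Action.
End Classification.

Arguments Wbar {Z Q} iota {K} S.
Arguments Vset {Q K} R p T J.
Arguments Tp_units {Q K} R p T.
Arguments Rp_units {Q K} R p.
Arguments is_Lu {Z Q} iota {K R p} u L.
Arguments is_lift {Z Q} iota {K} R p J W I.
Arguments U_group {Q K} R p T.
Arguments U_mul {Q K R p} g h.

Section Actions.
Variables (G X : Type) (U : set G) (mul : G -> G -> G) (one : G) (V : set X).
Variable act : G -> X -> X.

Definition free_action :=
  [/\ forall g x, U g -> V x -> V (act g x),
      forall x, V x -> act one x = x,
      forall g h x, U g -> U h -> V x -> act (mul g h) x = act g (act h x) &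
      forall g x, U g -> V x -> act g x = x -> g = one].

Definition orbits : set (set X) := [set [set act g x | g in U] | x in V].

End Actions.

(* Main.v *)
(* For fractional S-ideals I, J, local isomorphism at every maximal ideal amounts to
   1 being in (I : J)(J : I), at least when (I : I) = S ([weq]): an isomorphism
   of completions is multiplication by an element of the total quotient ring, and such
   an element can be approximated by elements of K. All that is needed about the
   completion at q is that S + z S^ = S^, that z S^ meets S in the localization of z S,
   and that elements of S outside q become units.

   If (I : I) = R then p I T = p I is contained in I, so any multiplier of I T lies in
   (R : p) = (p : p) = T. Hence I T is weakly equivalent to a unique J_i, and V_i is
   the set of the I with (I : I) = R and I T = J_i. Likewise U is the group of
   the invertible ideals L of R with L T = T, acting by multiplication: the orbits
   are the weak classes because I' = (I' : I) I when I and I' are weakly equivalent,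
   and the action is free because L I = I forces L = (I : I) = R. Finally, an
   invertible T-ideal M is descended to R by L = x R + p M, where x generates M
   modulo p M; this makes I -> J_i onto. *)
From HB Require Import structures.
Require Import Defs.
From mathcomp Require Import all_boot all_order all_algebra all_field.
From mathcomp Require Import ring.
From mathcomp Require Import boolp classical_sets functions.

Set Implicit Arguments.
Unset Strict Implicit.
Unset Printing Implicit Defensive.

Import GRing.Theory.
Local Open Scope ring_scope.
Local Open Scope classical_set_scope.

(** * Ideal arithmetic in a commutative ring *)

Section Products.
Variable A : comPzRingType.
Implicit Types (M N P I J : set A) (R S : subring A).

(** The obstacle is on the local side. An isomorphism lives over a completion, inside a total
    quotient ring, and even the canonical map out of [K] is a function only once regular elements of
    [S] are known to stay regular in the completion. All of this is reduced to denominators in [Z]: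
    a regular element of an order divides a nonzero integer, and for each nonzero integer z there
    are s outside q and an exponent c with s q^c inside z S. That single inclusion, an explicit form
    of Artin-Rees, yields regularity, density and contraction. It comes from Noetherian induction on
    the ideals of [S] containing z, where every prime is maximal.

    The criterion 1 in (I : J)(J : I) mentions no base ring. This lets one relation compare I with
    I' over R and I T with I' T over T, and it passes from the first pair to the second by mere
    multiplication.

    The element x generating M modulo p M exists because only finitely many maximal ideals of T
    contain p. *)

Definition add_closed M := M 0 /\ forall x y, M x -> M y -> M (x + y).

Lemma sum_closed M (T : Type) (s : seq T) (P : pred T) (F : T -> A) : add_closed M ->
  (forall i, P i -> M (F i)) -> M (\sum_(i <- s | P i) F i).
Proof. by move=> [M0 MD] h; apply: (big_ind M). Qed.

Lemma sum_closed_seq M (T : eqType) (s : seq T) (F : T -> A) : add_closed M ->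
  (forall i, i \in s -> M (F i)) -> M (\sum_(i <- s) F i).
Proof. by move=> ? h; rewrite big_seq; apply: sum_closed. Qed.

Lemma subring1 R : subring_set R 1. Proof. by case: (subringP R). Qed.
Lemma subringB R x y : subring_set R x -> subring_set R y -> subring_set R (x - y).
Proof. by case: (subringP R) => _ h _; apply: h. Qed.
Lemma subringM R x y : subring_set R x -> subring_set R y -> subring_set R (x * y).
Proof. by case: (subringP R) => _ _ h; apply: h. Qed.
Lemma subring0 R : subring_set R 0.
Proof. by rewrite -(subrr 1); apply: subringB; apply: subring1. Qed.
Lemma subringN R x : subring_set R x -> subring_set R (- x).
Proof. by move=> h; rewrite -sub0r; apply: subringB => //; apply: subring0. Qed.
Lemma subringD R x y : subring_set R x -> subring_set R y -> subring_set R (x + y).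
Proof. by move=> hx hy; rewrite -[y]opprK; apply: subringB => //; apply: subringN. Qed.
Lemma subring_add_closed R : add_closed R.
Proof. by split; [apply: subring0|move=> *; apply: subringD]. Qed.

Lemma subring_submodule R S : R `<=` S -> submodule R S.
Proof.
move=> RS; split; [exact: subring0|by move=> *; apply: subringD|].
by move=> r x /RS *; apply: subringM.
Qed.

Section Submodule.
Variables (R : subring A) (M : set A).
Hypothesis hM : submodule R M.

Lemma submod_add_closed : add_closed M. Proof. by case: hM. Qed.
Lemma submod0 : M 0. Proof. by case: hM. Qed.
Lemma submodD x y : M x -> M y -> M (x + y). Proof. by case: hM => _ h _; apply: h. Qed.
Lemma submodZ r x : subring_set R r -> M x -> M (r * x).
Proof. by case: hM => _ _; apply. Qed.
Lemma submodN x : M x -> M (- x).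
Proof. by rewrite -mulN1r; apply: submodZ; apply/subringN/subring1. Qed.
Lemma submodB x y : M x -> M y -> M (x - y).
Proof. by move=> hx hy; apply: submodD => //; apply: submodN. Qed.
End Submodule.

Lemma submodule_sub R S M : R `<=` S -> submodule S M -> submodule R M.
Proof. by move=> RS [h0 hD hZ]; split=> // r x /RS; apply: hZ. Qed.

Lemma mem_prods M N x y : M x -> N y -> prods M N (x * y).
Proof.
move=> hx hy; exists [:: (x, y)]; rewrite big_seq1; split=> // e.
by rewrite inE => /eqP->.
Qed.

Lemma prods_add_closed M N : add_closed (prods M N).
Proof.
split; first by exists [::]; rewrite big_nil.
move=> _ _ [s [hs ->]] [t [ht ->]]; exists (s ++ t); rewrite big_cat; split=> // e.
by rewrite mem_cat => /orP[/hs|/ht].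
Qed.

Lemma prodsP M N P : add_closed P -> (forall x y, M x -> N y -> P (x * y)) ->
  prods M N `<=` P.
Proof.
move=> hP h _ [s [hs ->]]; apply: sum_closed_seq => // e /hs [? ?]; exact: h.
Qed.

Lemma prods_mono M N M' N' : M `<=` M' -> N `<=` N' -> prods M N `<=` prods M' N'.
Proof.
move=> hM hN; apply: prodsP; first exact: prods_add_closed.
by move=> x y /hM hx /hN hy; apply: mem_prods.
Qed.

Lemma prodsC M N : prods M N = prods N M.
Proof.
suff h M' N' : prods M' N' `<=` prods N' M' by rewrite eqEsubset; split; apply: h.
apply: prodsP; first exact: prods_add_closed.
by move=> x y hx hy; rewrite mulrC; apply: mem_prods.
Qed.

Lemma prods_scale M N P a : (forall x, M x -> P (a * x)) ->
  forall z, prods M N z -> prods P N (a * z).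
Proof.
move=> h; apply: (@prodsP M N [set z | prods P N (a * z)]); first last.
  by move=> x y hx hy /=; rewrite mulrA; apply: mem_prods => //; apply: h.
have [h0 hD] := prods_add_closed P N.
by split=> /= [|x y]; rewrite ?mulr0 ?mulrDr //; apply: hD.
Qed.

Lemma prodsA M N P : prods M (prods N P) = prods (prods M N) P.
Proof.
suff h M' N' P' : prods M' (prods N' P') `<=` prods (prods M' N') P'.
  rewrite eqEsubset; split; first exact: h.
  by rewrite (prodsC (prods M N)) (prodsC M N) (prodsC M) (prodsC N P); apply: h.
apply: prodsP; first exact: prods_add_closed.
by move=> x y hx; apply: prods_scale => z hz; apply: mem_prods.
Qed.

Lemma prods_submodule R M N : submodule R M -> submodule R (prods M N).
Proof.
move=> hM; have [h0 hD] := prods_add_closed M N; split=> // r x hr.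
by apply: prods_scale => y; apply: (submodZ hM).
Qed.

Lemma prods_subring R M : submodule R M -> prods R M = M.
Proof.
move=> hM; rewrite eqEsubset; split.
  apply: prodsP; [exact: submod_add_closed hM|move=> r x; exact: (submodZ hM)].
by move=> x hx; rewrite -[x]mul1r; apply: mem_prods => //; apply: subring1.
Qed.

Lemma colon_submodule R I J : submodule R I -> submodule R (colon I J).
Proof.
move=> hI; split=> [x hx|a b ha hb x hx|r a hr ha x hx] /=.
- by rewrite mul0r; apply: (submod0 hI).
- by rewrite mulrDl; apply: (submodD hI); [apply: ha|apply: hb].
- by rewrite -mulrA; apply: (submodZ hI) => //; apply: ha.
Qed.

Lemma ideal_full R I : is_ideal R I -> I 1 -> I = R.
Proof.
move=> [hI IR] h1; rewrite eqEsubset; split=> // x hx.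
by rewrite -[x]mulr1; apply: (submodZ hI).
Qed.

(** The submodule R x + M. It serves three times: to enlarge a maximal ideal, to enlarge an ideal in
    Noetherian induction, and as the descended ideal x R + p M. *)
Definition adjoin R x M : set A := [set l | exists r m, [/\ subring_set R r, M m & l = r * x + m]].

Lemma adjoin_submodule R x M : submodule R M -> submodule R (adjoin R x M).
Proof.
move=> hM; split.
- by exists 0, 0; rewrite mul0r addr0; split=> //; [apply: subring0|apply: submod0 hM].
- move=> _ _ [r [m [hr hm ->]]] [r' [m' [hr' hm' ->]]]; exists (r + r'), (m + m').
  by split; [apply: subringD|apply: (submodD hM)|ring].
- move=> a _ ha [r [m [hr hm ->]]]; exists (a * r), (a * m).
  by split; [apply: subringM|apply: (submodZ hM)|ring].
Qed.

Lemma adjoin_sub R x M : M `<=` adjoin R x M.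
Proof. by move=> m hm; exists 0, m; split=> //; [apply: subring0|ring]. Qed.

Lemma adjoin_gen R x M : submodule R M -> adjoin R x M x.
Proof.
move=> hM; exists 1, 0.
by split; [apply: subring1|apply: (submod0 hM)|ring].
Qed.

Lemma adjoin_min R x M P : submodule R P -> P x -> M `<=` P -> adjoin R x M `<=` P.
Proof.
move=> hP hx hM _ [r [m [hr hm ->]]].
by apply: (submodD hP); [apply: (submodZ hP)|apply: hM].
Qed.

Lemma adjoin_ideal R x I : is_ideal R I -> subring_set R x -> is_ideal R (adjoin R x I).
Proof.
move=> [hI IR] hx; split; first exact: adjoin_submodule.
by apply: adjoin_min => //; apply: subring_submodule.
Qed.

Section Maximal.
Variables (R : subring A) (q : set A).
Hypothesis hq : maximal_ideal R q.

Lemma max_ideal : is_ideal R q. Proof. by case: hq. Qed.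
Lemma max_submod : submodule R q. Proof. by case: max_ideal. Qed.
Lemma max_sub : q `<=` R. Proof. by case: max_ideal. Qed.
Lemma max_1 : ~ q 1.
Proof. by move=> h; case: hq => _ + _; apply; apply: ideal_full => //; apply: max_ideal. Qed.

Lemma max_inv s : subring_set R s -> ~ q s -> exists2 t, subring_set R t & q (s * t - 1).
Proof.
move=> hs nqs; case: hq => hi _ /(_ _ (adjoin_ideal hi hs) (@adjoin_sub R s q)) [] e.
  by case: nqs; rewrite -e; apply: adjoin_gen; apply: max_submod.
have : adjoin R s q 1 by rewrite e; apply: subring1.
case=> t [m [ht hm e1]]; exists t => //; rewrite (_ : _ - 1 = - m); last by rewrite e1; ring.
exact: (submodN max_submod).
Qed.

Lemma max_prime : prime_ideal R q.
Proof.
split; [exact: max_ideal|exact: max_1|move=> x y hx hy hxy].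
case: (pselect (q x)); [by left|move=> /(max_inv hx) [t ht h]; right].
rewrite (_ : y = t * (x * y) - y * (x * t - 1)); last by ring.
by apply: (submodB max_submod); apply: (submodZ max_submod).
Qed.

Lemma max_not_sub q' : maximal_ideal R q' -> q' <> q -> exists2 s, q' s & ~ q s.
Proof.
move=> hq' ne; apply: contrapT => h; apply: ne.
case: (hq') => _ _ /(_ q max_ideal) [|//|].
  by move=> x hx; apply: contrapT => ?; apply: h; exists x.
by case: hq.
Qed.
End Maximal.

Lemma max_exists R I : is_ideal R I -> ~ I 1 -> exists2 q, maximal_ideal R q & I `<=` q.
Proof.
move=> hI nI1.
pose P X := X = set0 \/ [/\ is_ideal R X, ~ X 1 & I `<=` X].
have [F FP Ftot|X [PX Xmax]] := @Zorn_bigcup _ P.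
  case: (pselect (exists2 X, F X & X !=set0)) => [[X FX [x0 Xx0]]|h]; last first.
    left; rewrite -subset0 => x [X FX Xx]; case: h; exists X => //; by exists x.
  have Pne Y y : F Y -> Y y -> [/\ is_ideal R Y, ~ Y 1 & I `<=` Y].
    by move=> FY Yy; case: (FP _ FY) => // e; move: Yy; rewrite e.
  have [[[X0 _ _] _] _ IX] := Pne _ _ FX Xx0.
  right; split.
  - split; last by move=> x [Y FY Yx]; have [[_ +] _ _] := Pne _ _ FY Yx; apply.
    split; first by exists X.
      move=> x y [Y FY Yx] [Y' FY' Yy].
      have [[YD _] _ _] := Pne _ _ FY Yx; have [[YD' _] _ _] := Pne _ _ FY' Yy.
      by case: (Ftot _ _ FY FY') => /(_ _) s;
        [exists Y' => //; apply: (submodD YD') => //; apply: s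
        |exists Y => //; apply: (submodD YD) => //; apply: s].
    move=> r x hr [Y FY Yx]; exists Y => //.
    by have [[YD _] _ _] := Pne _ _ FY Yx; apply: (submodZ YD).
  - by move=> [Y FY Y1]; have [_ + _] := Pne _ _ FY Y1; apply.
  - by move=> x hx; exists X => //; apply: IX.
have PI : P I by right; split.
have I0 : I 0 by exact: submod0 hI.1.
case: PX => [e|[hX nX1 IX]].
  case: (Xmax I) => //; rewrite e; split; first exact: sub0set.
  by move=> h; exact: (h _ I0).
exists X => //; split=> //.
  by move=> e; apply: nX1; rewrite e; apply: subring1.
move=> Y hY XY; case: (pselect (Y 1)) => [Y1|nY1]; first by right; apply: ideal_full.
left; rewrite eqEsubset; split=> //; apply: contrapT => nYX.
by apply: (Xmax Y) => //; right; split=> //; apply: subset_trans XY.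
Qed.

Lemma ideal_not_max R I : is_ideal R I ->
  (forall q, maximal_ideal R q -> exists2 s, I s & ~ q s) -> I 1.
Proof.
move=> hI h; apply: contrapT => /(max_exists hI) [q hq Iq].
by case: (h q hq) => s /Iq.
Qed.

(** If 1 is a sum of products a b with a J in I and b I in J, then at each maximal ideal some a b is
    a unit, and multiplication by b is a local isomorphism from I to J. *)
Definition weq I J := prods (colon I J) (colon J I) 1.

End Products.

Section Cosets.
Variables (A : comPzRingType) (R : subring A) (N : set A).
Hypothesis hN : submodule R N.
Implicit Types (M I : set A).

Lemma rescl_refl x : rescl N x x.
Proof. by rewrite /rescl /= subrr; apply: submod0 hN. Qed.

Lemma rescl_eqP x y : rescl N x = rescl N y <-> N (y - x).
Proof.
split=> [e|h]; first by rewrite -[N _]/(rescl N x y) e; apply: rescl_refl.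
rewrite eqEsubset; split=> z; rewrite /rescl /= => hz.
  by rewrite (_ : z - y = (z - x) - (y - x)); [apply: (submodB hN)|ring].
by rewrite (_ : z - x = (z - y) + (y - x)); [apply: (submodD hN)|ring].
Qed.

Lemma resadd_rescl x y : resadd N (rescl N x) (rescl N y) = rescl N (x + y).
Proof.
rewrite eqEsubset; split=> z; rewrite /rescl /=.
  move=> [a [b [ha hb h]]].
  rewrite (_ : z - _ = (z - (a + b)) + ((a - x) + (b - y))); last by ring.
  by apply: (submodD hN) => //; apply: (submodD hN).
move=> h; exists x, y; split=> //=; rewrite subrr; exact: submod0 hN.
Qed.

(* [N'] is the subgroup of which the first factor is a coset. *)
Lemma resmul_rescl N' a x : N' 0 -> (forall n, N n -> N (a * n)) ->
  (forall m y, N' m -> rescl N x y -> N (m * y)) ->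
  resmul N (rescl N' a) (rescl N x) = rescl N (a * x).
Proof.
move=> h0 haN hN'; rewrite eqEsubset; split=> z; rewrite /rescl /=.
  move=> [c [y [hc hy h]]].
  rewrite (_ : z - _ = (z - c * y) + ((c - a) * y + a * (y - x))); last by ring.
  apply: (submodD hN) => //; apply: (submodD hN); [exact: hN'|exact: haN].
by move=> h; exists a, x; split=> //=; rewrite subrr //; apply: submod0 hN.
Qed.

Lemma resq_rescl M x : add_closed M -> N `<=` M -> (forall y, M y -> M (- y)) ->
  resq M N (rescl N x) <-> M x.
Proof.
move=> [M0 MD] NM MN; split=> [[y hy /rescl_eqP h]|h]; last by exists x.
rewrite (_ : x = y + (x - y)); last by ring.
by apply: MD => //; apply: NM.
Qed.
End Cosets.

(** * Completions *)

Section CompletionTheory.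
Variables (A : comPzRingType) (I : set A).
Hypothesis I_inv : forall s, ~ I s -> exists t, I (s * t - 1).

Local Notation pow := (idpow I).
Local Notation hat := (to_completion I).

Lemma idpow_add_closed n : add_closed (pow n).
Proof. by split; [apply: idpow0|move=> x y; apply: idpowD]. Qed.

Lemma idpowB n x y : pow n x -> pow n y -> pow n (x - y).
Proof. by move=> hx hy; apply: idpowD => //; apply: idpowN. Qed.

(** Powers of a maximal ideal are primary: with t inverse to s modulo [I], x equals t (s x) up to an
    element of [I] times x, so membership climbs one power at a time. *)
Lemma idpow_primary n s x : ~ I s -> pow n (s * x) -> pow n x.
Proof.
move=> /I_inv [t ht]; elim: n x => // n IHn x h.
rewrite (_ : x = t * (s * x) - (s * t - 1) * x); last by ring.
apply: idpowB; first exact: idpowM.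
by apply: mem_prods => //; apply/IHn/idpowS.
Qed.

Lemma completion_lim (a : nat -> A) : (forall n, pow n (a n.+1 - a n)) ->
  exists r : completion I, forall n, r n = rescl (pow n) (a n).
Proof.
move=> h; suff H n : resq setT (pow n) (rescl (pow n) (a n)) /\
    rescl (pow n.+1) (a n.+1) `<=` rescl (pow n) (a n).
  by exists (Completion H).
split=> [|y]; first by exists (a n).
move=> /idpowS; rewrite /rescl /= => hy.
rewrite (_ : y - _ = (y - a n.+1) + (a n.+1 - a n)); last by ring.
exact: idpowD.
Qed.

Lemma hatM_proj a b r n : (r : completion I) n = rescl (pow n) b ->
  (hat a * r) n = rescl (pow n) (a * b).
Proof. by move=> e; rewrite -[LHS]/(resmul _ _ _) e resmul_cl. Qed.

Lemma rescl_pow n a b : rescl (pow n) a = rescl (pow n) b <-> pow n (b - a).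
Proof. by rewrite -resclP. Qed.

Lemma hat_unit s : ~ I s -> exists t, hat s * t = 1.
Proof.
move=> ns; have [u hu] := I_inv ns.
have ex n : exists t, pow n (s * t - 1).
  elim: n => [|n [t ht]]; first by exists 0.
  (* A correction step: the new error is minus the old one times [s * u - 1], which lies in [I]. *)
  exists (t - u * (s * t - 1)).
  rewrite (_ : _ - 1 = - ((s * u - 1) * (s * t - 1))); last by ring.
  by apply/idpowN/mem_prods.
have [t ht] := choice ex.
have [n|r hr] := @completion_lim t.
  apply: (idpow_primary ns).
  rewrite (_ : s * _ = (s * t n.+1 - 1) - (s * t n - 1)); last by ring.
  by apply: idpowB => //; apply: idpowS.
exists r; apply: completion_eq => n; rewrite (hatM_proj _ (hr n)).
apply/rescl_pow; rewrite -opprB; exact: idpowN.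
Qed.

Section Denominator.
Variables (z s : A) (c : nat).
Hypotheses (zreg : regular z) (ns : ~ I s).
Hypothesis hc : forall x, pow c x -> exists y, s * x = z * y.

(** Artin-Rees with the explicit shift [c]: s I^(n+c) is contained in z I^n. *)
Lemma idpow_denom n x : pow (n + c) x -> exists2 y, pow n y & s * x = z * y.
Proof.
elim: n x => [|n IHn] x /=; first by move=> /hc [y ->]; exists y.
apply: (@prodsP _ _ _ [set x | exists2 y, pow n.+1 y & s * x = z * y]).
  split; first by exists 0; [apply: idpow0|ring].
  move=> x1 x2 [y1 h1 e1] [y2 h2 e2]; exists (y1 + y2); first exact: idpowD.
  by rewrite !mulrDr e1 e2.
move=> x1 x2 h1 /IHn [y hy e]; exists (x1 * y); first exact: mem_prods.
by rewrite mulrCA e; ring.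
Qed.

(** If z r = 0, an approximation a of r has z a in I^(n+c). Then s z a = z y with y in I^n, and
    cancelling z and then s puts a in I^n. *)
Lemma hat_regular : regular (hat z).
Proof.
move=> r e; apply: completion_eq => n.
have [a _ ra] := completionP r (n + c).
rewrite (ra n (leq_addr _ _)).
have : (hat z * r) (n + c)%N = (0 : completion I) (n + c)%N by rewrite e.
rewrite (hatM_proj _ (ra _ (leqnn _))) => /(@rescl_pow _ _ 0).
rewrite sub0r -mulrN => /idpow_denom [y hy].
rewrite mulrCA => /(regularI zreg) e'.
by apply/rescl_pow; rewrite sub0r; apply: (idpow_primary ns); rewrite e'.
Qed.

(** An approximation a of r to order [c] suffices: s (r - a) is divisible by z at every level, the
    quotients converge, and s is a unit of the completion. *)
Lemma hat_dense r : exists a r', r = hat a + hat z * r'.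
Proof.
have [a ra _] := completionP r c.
(* The approximation d of order n + c agrees with a to order c, hence has s (d - a) in z A; the
   shift by c is what later makes the quotients b coherent to order n. *)
have ex n : exists b, exists2 d, s * (d - a) = z * b & r (n + c)%N = rescl (pow (n + c)) d.
  have [d rd /(_ c (leq_addl _ _))] := completionP r (n + c).
  rewrite ra => /rescl_pow /(@idpow_denom 0) [b _ e].
  by exists b, d.
have [b hb] := choice ex.
have [n|r' hr'] := @completion_lim b.
  have [d ed rd] := hb n; have [d' ed' rd'] := hb n.+1.
  have : pow (n + c)%N (d' - d).
    have [e re he] := completionP r (n.+1 + c).
    move: rd'; rewrite re => /rescl_pow; rewrite addSn => /idpowS h1.
    move: rd; rewrite (he (n + c)%N) ?addSn // => /rescl_pow h2.
    rewrite (_ : d' - d = (d' - e) - (d - e)); last by ring.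
    exact: idpowB.
  move=> /idpow_denom [y hy e]; rewrite (_ : _ - _ = y) //.
  apply: (regularI zreg); rewrite mulrBr -ed -ed' -e; ring.
have [t ht] := hat_unit ns.
exists a, (t * r').
suff e : hat s * (r - hat a) = hat z * r'.
  rewrite [hat z * _]mulrCA -e mulrA [t * _]mulrC ht mul1r; ring.
apply: completion_eq => n; rewrite (hatM_proj _ (hr' n)).
have [d ed rd] := hb n.
rewrite -ed; apply: hatM_proj.
rewrite -[LHS]/(resadd _ (r n) ((hat (-1) * hat a) n)).
have [e _ he] := completionP r (n + c).
rewrite (hatM_proj (-1) (erefl (hat a n))).
have /rescl_pow hed : rescl (pow (n + c)) e = rescl (pow (n + c)) d by rewrite -rd he.
have -> : r n = rescl (pow n) d.
  rewrite he ?leq_addr //; apply/rescl_pow.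
  elim: (c) hed => [|k IHk]; rewrite ?addn0 // addnS => /idpowS; exact: IHk.
by rewrite resadd_cl mulN1r.
Qed.

(** Replacing r by its approximation b of order [c] leaves an error z b - a in I^c, which s makes
    divisible by z. *)
Lemma hat_divides a r : hat a = hat z * r -> exists y, s * a = z * y.
Proof.
have [b rb _] := completionP r c.
move=> e; have : hat a c = (hat z * r) c by rewrite e.
rewrite (hatM_proj _ rb) => /(@rescl_pow _ a) /hc [y {}e]; exists (s * b - y).
by rewrite mulrBr -e; ring.
Qed.
End Denominator.

Lemma idpow_mul m n : prods (pow m) (pow n) = pow (m + n).
Proof.
elim: m => [|m IHm] /=; last by rewrite -prodsA IHm.
rewrite add0n eqEsubset; split=> [|x hx].
  by apply: prodsP; [apply: idpow_add_closed|move=> x y _; apply: idpowM].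
by rewrite -[x]mul1r; apply: mem_prods.
Qed.
End CompletionTheory.

(** * Finitely generated modules over a Noetherian ring *)

Section Span.
Variables (Z A : comPzRingType) (f : {rmorphism Z -> A}).
Implicit Types (s t : seq A) (M : set A).

Definition zmodule M := add_closed M /\ forall c x, M x -> M (f c * x).

(** Recursive in the list of generators, so that [zmodule_noeth] can remove one generator at a
    time. *)
Fixpoint zspan s : set A :=
  if s is g :: s' then [set x | exists c y, zspan s' y /\ x = f c * g + y] else [set 0].

Lemma zspan_ordE m (g : 'I_m -> A) :
  [set x | exists c : 'I_m -> Z, x = \sum_(i < m) f (c i) * g i] = zspan (codom g).
Proof.
rewrite codomE.
elim: m g => [|m IHm] g.
  rewrite enum_ord0 /= eqEsubset; split=> x /=; first by case=> c ->; rewrite big_ord0.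
  by move=> ->; exists (fun=> 0); rewrite big_ord0.
rewrite enum_ordSl /= -map_comp -(IHm (fun i => g (lift ord0 i))).
rewrite eqEsubset; split=> x /=.
  move=> [c ->]; rewrite big_ord_recl; exists (c ord0); eexists; split; last by [].
  by exists (fun i => c (lift ord0 i)).
move=> [c [_ [[d ->] ->]]].
exists (fun i => if unlift ord0 i is Some j then d j else c).
rewrite big_ord_recl unlift_none; congr (_ + _).
by apply: eq_bigr => i _; rewrite liftK.
Qed.

Lemma zspan_seqE s : exists m (g : 'I_m -> A),
  zspan s = [set x | exists c : 'I_m -> Z, x = \sum_(i < m) f (c i) * g i].
Proof.
exists (size s), (fun i => s`_i); rewrite zspan_ordE; congr zspan.
rewrite codomE; apply: (@eq_from_nth _ 0) => [|i hi]; first by rewrite size_map size_enum_ord.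
by rewrite (nth_map (Ordinal hi)) ?size_enum_ord // nth_enum_ord.
Qed.

Lemma zmodule_zspan s : zmodule (zspan s).
Proof.
elim: s => [|g s [[h0 hD] hZ]] /=.
  by split=> [|c x ->]; rewrite ?mulr0 //; split=> // x y -> ->; rewrite addr0.
split; first split.
- by exists 0, 0; rewrite rmorph0; split=> //; ring.
- move=> _ _ [c [y [hy ->]]] [c' [y' [hy' ->]]]; exists (c + c'), (y + y').
  by rewrite rmorphD; split; [apply: hD|ring].
- move=> d _ [c [y [hy ->]]]; exists (d * c), (f d * y).
  by rewrite rmorphM; split; [apply: hZ|ring].
Qed.

Lemma zspan_min s M : zmodule M -> (forall x, x \in s -> M x) -> zspan s `<=` M.
Proof.
move=> [[h0 hD] hZ]; elim: s => [|g s IHs] /= h; first by move=> _ ->.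
move=> _ [c [y [hy ->]]]; apply: hD; first by apply/hZ/h/mem_head.
by apply: IHs hy => x hx; apply: h; rewrite inE hx orbT.
Qed.

Lemma zspan_mem s x : x \in s -> zspan s x.
Proof.
elim: s => // g s IHs; have [[h0 hD] hZ] := zmodule_zspan s.
rewrite inE => /orP[/eqP->|/IHs h]; first by exists 1, 0; rewrite rmorph1; split=> //; ring.
by exists 0, x; rewrite rmorph0; split=> //; ring.
Qed.

Hypothesis noeth : forall I : set Z, is_ideal setT I ->
  exists m (g : 'I_m -> Z),
     I = [set x | exists c : 'I_m -> Z, x = \sum_(i < m) c i * g i].

(** Induction on the generators of the ambient module: M is generated by its intersection with the
    span of the tail, together with lifts of generators of the ideal of coefficients along the
    head. *)
Lemma zmodule_noeth s M : zmodule M -> M `<=` zspan s -> exists t, M = zspan t.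
Proof.
elim: s M => [|g s IHs] M hM sub; have [[M0 MD] MZ] := hM.
  by exists [::]; rewrite /= eqEsubset; split=> // x ->.
pose M' := M `&` zspan s; have [[h0 hD] hZ] := zmodule_zspan s.
have [|x [] //|t et] := IHs M'.
  split; first by split=> // x y [? ?] [? ?]; split; [apply: MD|apply: hD].
  by move=> c x [? ?]; split; [apply: MZ|apply: hZ].
(* The ideal of the coefficients along [g] of the elements of [M]. *)
pose I : set Z := [set c | exists2 y, zspan s y & M (f c * g + y)].
have [|m [a ea]] := noeth (I := I).
  split=> //; split.
  - by exists 0 => //; rewrite rmorph0 mul0r addr0.
  - move=> c d [y hy h] [y' hy' h']; exists (y + y'); first exact: hD.
    rewrite rmorphD (_ : _ + _ = (f c * g + y) + (f d * g + y')); last by ring.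
    exact: MD.
  - move=> r c _ [y hy h]; exists (f r * y); first exact: hZ.
    rewrite rmorphM (_ : _ + _ = f r * (f c * g + y)); last by ring.
    exact: MZ.
have Ia i : I (a i).
  rewrite ea; exists (fun j => (j == i)%:R).
  rewrite (bigD1 i) //= eqxx mul1r big1 ?addr0 // => j /negPf ->; exact: mul0r.
have [x hx] : exists x : 'I_m -> A, forall i, M (x i) /\ zspan s (x i - f (a i) * g).
  suff /choice [x hx] : forall i, exists x, M x /\ zspan s (x - f (a i) * g) by exists x.
  move=> i; have [y hy h] := Ia i; exists (f (a i) * g + y); split=> //.
  by rewrite (_ : _ - _ = y) //; ring.
exists (codom x ++ t).
have hN := zmodule_zspan (codom x ++ t).
rewrite eqEsubset; split; last first.
  apply: zspan_min => // y; rewrite mem_cat => /orP[/codomP [i ->]|/zspan_mem].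
    by have [] := hx i.
  by rewrite -et => -[].
move=> y My; have [c [y' [hy' ey]]] := sub _ My.
have : I c by exists y'; rewrite -?ey.
rewrite ea => -[d ec].
(* An element of [M] with the same coefficient along [g] as [y], so that [y - w] falls into [M']. *)
pose w := \sum_(i < m) f (d i) * x i.
have Nw : zspan (codom x ++ t) w.
  apply: sum_closed => [|i _]; first by case: hN.
  case: hN => _; apply; apply: zspan_mem; rewrite mem_cat codom_f //.
have Mw : M w by apply: sum_closed => [|i _]; [by split|apply: (MZ); have [] := hx i].
suff Nd : zspan (codom x ++ t) (y - w).
  by rewrite (_ : y = (y - w) + w); [case: hN => -[_ +] _; apply|ring].
have : M' (y - w).
  have mN v : f (-1) * v = - v by rewrite rmorphN rmorph1 mulN1r.
  split; first by apply: MD => //; rewrite -mN; apply: MZ.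
  rewrite (_ : y - w = y' + f (-1) * \sum_(i < m) f (d i) * (x i - f (a i) * g)).
    apply: (hD) => //; apply: (hZ); apply: (@sum_closed _ (zspan s)) => [|i _]; first exact: (conj h0 hD).
    by apply: hZ; have [] := hx i.
  under eq_bigr do rewrite mulrBr mulrA -rmorphM.
  by rewrite mN sumrB -mulr_suml -rmorph_sum -ec ey /w; ring.
rewrite et; apply: zspan_min => // v hv; apply: zspan_mem.
by rewrite mem_cat hv orbT.
Qed.

(** The ascending chain condition in the form of a maximal element. Zorn's lemma applies because the
    union of a chain is finitely generated, hence equal to one of its members. *)
Lemma zmodule_max s (P : set (set A)) : (forall M, P M -> zmodule M /\ M `<=` zspan s) ->
  P !=set0 -> exists2 M, P M & forall N, P N -> M `<=` N -> N = M.
Proof.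
move=> hP [M0 PM0].
pose P' X := X = set0 \/ P X.
have [F FP Ftot|X [PX Xmax]] := @Zorn_bigcup _ P'.
  case: (pselect (exists2 X, F X & X !=set0)) => [[X FX [x0 Xx0]]|h]; last first.
    left; rewrite -subset0 => x [X FX Xx]; case: h; exists X => //; by exists x.
  have FP' Y y : F Y -> Y y -> P Y by move=> FY Yy; case: (FP _ FY) => // e; move: Yy; rewrite e.
  have [[[X0 _] _] _] := hP _ (FP' _ _ FX Xx0).
  right.
  have [||t et] := @zmodule_noeth s (\bigcup_(Y in F) Y).
  - split; first split; first by exists X.
      move=> x y [Y FY Yx] [Y' FY' Yy].
      have [[[_ YD] _] _] := hP _ (FP' _ _ FY Yx).
      have [[[_ YD'] _] _] := hP _ (FP' _ _ FY' Yy).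
      by case: (Ftot _ _ FY FY') => sub;
        [exists Y' => //; apply: YD' => //; apply: sub
        |exists Y => //; apply: YD => //; apply: sub].
    move=> c x [Y FY Yx]; exists Y => //.
    by have [[_ +] _] := hP _ (FP' _ _ FY Yx); apply.
  - by move=> x [Y FY Yx]; have [_] := hP _ (FP' _ _ FY Yx); apply.
  (* The finitely many generators of the union all lie in a single member of the chain. *)
  have [Y [FY [y Yy] tY]] : exists Y, [/\ F Y, Y !=set0 & forall x, x \in t -> Y x].
    have : forall x, x \in t -> (\bigcup_(Y in F) Y) x.
      by move=> x; rewrite et; apply: zspan_mem.
    elim: (t) => [|g r IHr] h; first by exists X; split=> //; exists x0.
    have [|Y [FY [y Yy] Yr]] := IHr; first by move=> x hx; apply: h; rewrite inE hx orbT.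
    have [Y' FY' Yg] := h g (mem_head _ _).
    case: (Ftot _ _ FY FY') => sub; [exists Y'|exists Y]; (split=> //; first by [exists g|exists y]);
      move=> x; rewrite inE => /orP[/eqP->|/Yr] //; exact: sub.
  have PY := FP' _ _ FY Yy.
  rewrite (_ : \bigcup_(_ in F) _ = Y) // eqEsubset; split; last by move=> x Yx; exists Y.
  by rewrite et; apply: zspan_min => //; case: (hP _ PY).
have PX' : P X.
  case: PX => // eX; case: (Xmax M0); last by right.
  rewrite eX; split; first exact: sub0set.
  by have [[[h _] _] _] := hP _ PM0; move=> /(_ _ h).
exists X => // N PN XN; rewrite eqEsubset; split=> //.
apply: contrapT => nNX; apply: (Xmax N); by [split|right].
Qed.
End Span.

(** * Lattices and orders *)

Section Orders.
Variables (Z : idomainType) (Q : fieldType) (iota : {rmorphism Z -> Q}).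
Hypotheses (hQ : fraction_field iota) (hZ : dedekind_domain iota).
Variable K : comAlgType Q.
Implicit Types (S T : subring K) (M N I J q : set K).

(** Through this ring morphism scaling by [Z] becomes multiplication in [K], and Z-submodules of [K]
    become instances of [zmodule]. *)
Definition kap (z : Z) : K := (iota z)%:A.
Arguments kap : simpl never.

Fact kap_zmod : zmod_morphism kap.
Proof. by move=> x y; rewrite /kap rmorphB scalerBl. Qed.
Fact kap_monoid : monoid_morphism kap.
Proof.
by split=> [|x y]; rewrite /kap ?rmorph1 ?scale1r // rmorphM -scalerA mulr_algl.
Qed.
HB.instance Definition _ := GRing.isZmodMorphism.Build Z K kap kap_zmod.
HB.instance Definition _ := GRing.isMonoidMorphism.Build Z K kap kap_monoid.

(** For an S-submodule this amounts to being a lattice ([fracP]). A single z serves both as an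
    element of [I] and as a common denominator of [I], since the two integers can be multiplied
    together. *)
Definition bounded S I :=
  exists2 z, z != 0 & I (kap z) /\ forall x, I x -> subring_set S (kap z * x).

Lemma kapE z x : kap z * x = iota z *: x.
Proof. exact: mulr_algl. Qed.

Lemma iota_neq0 z : z != 0 -> iota z != 0.
Proof. by apply: contra_neq => e; apply: hQ.1; rewrite e rmorph0. Qed.

Lemma kap_inv z : z != 0 -> exists z', kap z * z' = 1.
Proof.
move=> /iota_neq0 h; exists ((iota z)^-1 *: 1).
by rewrite kapE scalerA divff // scale1r.
Qed.

Lemma kap_regular z : z != 0 -> regular (kap z).
Proof.
move=> /kap_inv [z' e] x h; rewrite -[x]mul1r -e mulrAC h mul0r //.
Qed.

Lemma lattice_zspan M : lattice iota M -> exists s, M = zspan kap s.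
Proof.
move=> [[m [g eg]] _]; exists (codom g); rewrite -zspan_ordE eg.
by rewrite eqEsubset; split=> x [c ->]; exists c; apply: eq_bigr => i _; rewrite kapE.
Qed.

Lemma denom_closed (N : set K) : zmodule kap N ->
  add_closed [set x | exists2 z, z != 0 & N (kap z * x)].
Proof.
move=> [[N0 ND] NZ]; split=> [|x y /= [z hz h] [z' hz' h']].
  by exists 1; rewrite ?oner_neq0 ?mulr0.
exists (z * z'); first by rewrite mulf_neq0.
rewrite mulrDr rmorphM; apply: ND; last by rewrite -mulrA; apply: NZ.
by rewrite mulrAC mulrC; apply: NZ.
Qed.

Lemma denom_exists N d (b : 'I_d -> K) : zmodule kap N -> Q_basis b ->
  (forall i, N (b i)) -> forall x, exists2 z, z != 0 & N (kap z * x).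
Proof.
move=> hN hb Nb x; have [c [-> _]] := hb x.
apply: (@sum_closed _ [set x | exists2 z, z != 0 & N (kap z * x)]) => [|i _ /=].
  exact: denom_closed.
have [u [v [v0 ->]]] := hQ.2 (c i); exists v => //.
rewrite kapE scalerA mulrC divfK ?iota_neq0 // -kapE.
by case: hN => _; apply.
Qed.

Lemma zspan_denom N s : zmodule kap N -> (forall x, exists2 z, z != 0 & N (kap z * x)) ->
  exists2 z, z != 0 & forall x, zspan kap s x -> N (kap z * x).
Proof.
move=> hN h; have [[N0 ND] NZ] := hN; elim: s => [|g s [z z0 hz]] /=.
  by exists 1; rewrite ?oner_neq0 // => x ->; rewrite mulr0.
have [z' z'0 hz'] := h g; exists (z * z'); first by rewrite mulf_neq0.
move=> _ [c [y [/hz hy ->]]]; rewrite rmorphM.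
rewrite (_ : _ * _ = kap z * (kap c * (kap z' * g)) + kap z' * (kap z * y)); last by ring.
by apply: ND; [apply/NZ/NZ|apply: NZ].
Qed.

Lemma lattice_denom M : lattice iota M -> zmodule kap M ->
  forall x, exists2 z, z != 0 & M (kap z * x).
Proof. by move=> [_ [d [b [hb Mb]]]] hM; apply: denom_exists hb Mb. Qed.

Lemma noethZ (I : set Z) : is_ideal setT I -> exists m (g : 'I_m -> Z),
  I = [set x | exists c : 'I_m -> Z, x = \sum_(i < m) c i * g i].
Proof. by case: hZ => _ h _ _; apply: h. Qed.

Section Order.
Variable S : subring K.
Hypothesis hS : is_order iota S.

Lemma order_zmodule : zmodule kap S.
Proof. by have [s ->] := lattice_zspan hS; apply: zmodule_zspan. Qed.

Lemma order_kap z : subring_set S (kap z).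
Proof.
by have [_ h] := order_zmodule; rewrite -[kap z]mulr1; apply/h/subring1.
Qed.

Lemma order_denom x : exists2 z, z != 0 & subring_set S (kap z * x).
Proof. exact: (lattice_denom hS order_zmodule). Qed.

Lemma submod_zmodule M : submodule S M -> zmodule kap M.
Proof.
move=> hM; split; first exact: submod_add_closed hM.
by move=> c x; apply: (submodZ hM); apply: order_kap.
Qed.

(** A bounded [M] lies in z^-1 S, which is finitely generated over the Noetherian ring [Z]. *)
Lemma bounded_zspan M : submodule S M -> bounded S M -> exists s, M = zspan kap s.
Proof.
move=> hM [z z0 [_ hz]]; have [s es] := lattice_zspan hS; have [z' ez'] := kap_inv z0.
apply: (@zmodule_noeth _ _ kap noethZ [seq z' * g | g <- s]); first exact: submod_zmodule.
move=> x /hz; rewrite es => h; rewrite (_ : x = z' * (kap z * x)); last first.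
  by rewrite mulrA [z' * _]mulrC ez' mul1r.
apply: (@zspan_min _ _ kap s [set y | zspan kap [seq z' * g | g <- s] (z' * y)]) h.
  have [[h0 hD] hZ'] := zmodule_zspan kap [seq z' * g | g <- s].
  split; first split=> /= [|a b ha hb]; rewrite ?mulr0 ?mulrDr //; first exact: hD.
  by move=> c a ha /=; rewrite mulrCA; apply: hZ'.
by move=> g hg /=; apply: zspan_mem; apply: map_f.
Qed.

Lemma fracP I : fractional_ideal iota S I <-> submodule S I /\ bounded S I.
Proof.
split=> [[hI hL]|[hI hB]]; split=> //.
  have hM := submod_zmodule hI.
  have [z z0 hz] := lattice_denom hL hM 1.
  have [s es] := lattice_zspan hL.
  have [z' z'0 hz'] := zspan_denom s order_zmodule order_denom.
  exists (z * z'); first by rewrite mulf_neq0.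
  rewrite rmorphM; split; last first.
    by move=> x; rewrite es => /hz' h; rewrite -mulrA; apply: subringM => //; apply: order_kap.
  rewrite mulr1 in hz; rewrite mulrC; apply: (submodZ hI) => //; exact: order_kap.
split.
  have [s ->] := bounded_zspan hI hB; have [m [g ->]] := zspan_seqE kap s.
  exists m, g; rewrite eqEsubset.
  by split=> x [c ->]; exists c; apply: eq_bigr => i _; rewrite kapE.
have [_ [d [b [hb Sb]]]] := hS; have [z z0 [hz _]] := hB.
have [z' ez'] := kap_inv z0.
(* A Q-basis contained in [S], scaled by a unit of [K] that belongs to [I], is a Q-basis contained
   in [I]. *)
exists d, (fun i => kap z * b i); split; last first.
  by move=> i; rewrite mulrC; apply: (submodZ hI).
move=> x; have [c [ec hc]] := hb (z' * x); exists c; split.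
  rewrite -[x]mul1r -ez' -mulrA ec mulr_sumr.
  by apply: eq_bigr => i _; rewrite scalerAr.
move=> c' ec'; apply: hc; rewrite ec' mulr_sumr; apply: eq_bigr => i _.
by rewrite -scalerAr mulrA [z' * _]mulrC ez' mul1r.
Qed.

Lemma bounded_prods I J : bounded S I -> bounded S J -> bounded S (prods I J).
Proof.
move=> [z z0 [hz hzI]] [z' z'0 [hz' hzJ]]; exists (z * z'); first by rewrite mulf_neq0.
rewrite rmorphM; split; first exact: mem_prods.
move=> x; apply: (@prodsP _ _ _ [set x | subring_set S (kap z * kap z' * x)]).
  split=> /= [|a b ha hb]; rewrite ?mulr0 ?mulrDr; [exact: subring0|exact: subringD].
move=> a b /hzI ha /hzJ hb /=.
by rewrite mulrACA; apply: subringM.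
Qed.

Lemma bounded_colon I J : submodule S I -> bounded S I -> bounded S J ->
  bounded S (colon I J).
Proof.
move=> hI [z z0 [hz hzI]] [z' z'0 [hz' hzJ]]; exists (z * z'); first by rewrite mulf_neq0.
rewrite rmorphM; split=> [x /hzJ hx|a /(_ _ hz') /hzI].
  by rewrite -mulrA mulrC; apply: (submodZ hI).
by rewrite [a * _]mulrC mulrA.
Qed.

Lemma bounded_self : bounded S S.
Proof.
exists 1; rewrite ?oner_neq0 // rmorph1; split=> [|x]; first exact: subring1.
by rewrite mul1r.
Qed.

Lemma bounded_between I J L : bounded S I -> bounded S J -> I `<=` L -> L `<=` J ->
  submodule S L -> bounded S L.
Proof.
move=> [z z0 [hz _]] [z' z'0 [_ hzJ]] IL LJ hL; exists (z * z'); first by rewrite mulf_neq0.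
rewrite rmorphM; split; last first.
  move=> x /LJ /hzJ; rewrite -mulrA; apply: subringM; exact: order_kap.
by rewrite mulrC; apply: (submodZ hL); [apply: order_kap|apply: IL].
Qed.
End Order.

Lemma bounded_trans S T I : is_order iota S -> bounded S T -> submodule T I ->
  bounded T I -> bounded S I.
Proof.
move=> hS [z z0 [hz hzT]] hI [z' z'0 [hz' hzI]]; exists (z * z'); first by rewrite mulf_neq0.
rewrite rmorphM; split; first by apply: (submodZ hI).
by move=> x /hzI /hzT; rewrite mulrA.
Qed.

Lemma order_overring S T : is_order iota S -> S `<=` T -> bounded S T -> is_order iota T.
Proof.
move=> hS ST hT.
by have [_] : fractional_ideal iota S T by apply/(fracP hS); split; first exact: subring_submodule.
Qed.

Lemma bounded_up S T I : S `<=` T -> bounded S I -> bounded T I.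
Proof. by move=> ST [z z0 [hz h]]; exists z => //; split=> // x /h /ST. Qed.

End Orders.

(** * Prime ideals of an order *)

Section Integrality.
Variables (Z : idomainType) (Q : fieldType) (iota : {rmorphism Z -> Q}).
Hypotheses (hQ : fraction_field iota) (hZ : dedekind_domain iota).
Variable K : comAlgType Q.
Implicit Types (I q : set K) (f g : {poly Z}).
Variable S : subring K.
Hypothesis hS : is_order iota S.

Local Notation kap := (kap iota K).
Local Notation ev f x := (map_poly kap f).[x].

Let hSk := order_kap hS.

Lemma ev_MXaddC f c x : ev (f * 'X + c%:P) x = ev f x * x + kap c.
Proof. by rewrite rmorphD rmorphM /= map_polyX map_polyC !hornerE. Qed.

Lemma ev_order f x : subring_set S x -> subring_set S (ev f x).
Proof.
move=> hx; elim/poly_ind: f => [|f c IHf]; first by rewrite rmorph0 horner0; apply: subring0.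
by rewrite ev_MXaddC; apply: subringD => //; apply: subringM.
Qed.

(** The polynomial values at x form a submodule of [S], generated by the values of polynomials of
    size at most some N; x^N is then itself such a value. *)
Lemma order_integral x : subring_set S x -> exists2 f, f \is monic & ev f x = 0.
Proof.
move=> hx; have [s es] := lattice_zspan hS.
have zmod_ev (P : pred {poly Z}) : P 0 -> (forall f g, P f -> P g -> P (f + g)) ->
    (forall c f, P f -> P (c *: f)) -> zmodule kap [set y | exists2 f, P f & y = ev f x].
  move=> P0 PD PZ; split; first split.
  - by exists 0; rewrite ?rmorph0 ?horner0.
  - by move=> _ _ [f hf ->] [g hg ->]; exists (f + g); rewrite ?rmorphD ?hornerD //; apply: PD.
  - move=> c _ [f hf ->]; exists (c *: f); first exact: PZ.
    by rewrite -mul_polyC rmorphM /= map_polyC hornerM hornerC.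
have [||t et] := @zmodule_noeth _ _ kap (noethZ hZ) s [set y | exists2 f, true & y = ev f x].
- exact: (zmod_ev predT).
- by move=> _ [f _ ->]; rewrite -es; apply: ev_order.
have [N hN] : exists N, forall y, y \in t -> exists2 f : {poly Z}, (size f <= N)%N & y = ev f x.
  have : forall y, y \in t -> exists2 f, true & y = ev f x.
    by move=> y /(zspan_mem kap); rewrite -et.
  elim: (t) => [|a r IHr] h; first by exists 0%N.
  have [|N hN] := IHr; first by move=> y hy; apply: h; rewrite inE hy orbT.
  have [f _ ef] := h a (mem_head _ _); exists (maxn N (size f)) => y.
  rewrite inE => /orP[/eqP->|/hN [g hg ->]]; first by exists f => //; rewrite leq_maxr.
  by exists g => //; rewrite leq_max hg.
have : [set y | exists2 f : {poly Z}, (size f <= N)%N & y = ev f x] (x ^+ N).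
  apply: (@zspan_min _ _ kap t) => //.
    apply: (zmod_ev (fun f : {poly Z} => (size f <= N)%N)) => [|f g hf hg|c f hf].
    - by rewrite size_poly0.
    - by rewrite (leq_trans (size_polyD _ _)) // geq_max hf.
    - by rewrite (leq_trans (size_scale_leq _ _)).
  rewrite -et; exists 'X^N => //; by rewrite rmorphXn /= map_polyX hornerXn.
move=> /= [f hf ef]; exists ('X^N - f).
  by rewrite monicE lead_coefDl ?lead_coefXn // size_polyN size_polyXn ltnS.
by rewrite rmorphB rmorphXn /= map_polyX hornerD hornerN hornerXn ef subrr.
Qed.

(** Minimality serves to control the constant coefficient: if a minimal relation is g X + c, then g
    is a shorter monic polynomial and its value cannot lie in [P]. *)
Lemma min_monic (P : set K) x : P 0 -> subring_set S x ->
  exists f, [/\ f \is monic, P (ev f x) &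
    forall g, g \is monic -> (size g < size f)%N -> ~ P (ev g x)].
Proof.
move=> P0 /order_integral [f0 m0 e0].
have ex : exists n, `[< exists f, [/\ f \is monic, size f = n & P (ev f x)] >].
  by exists (size f0); apply/asboolP; exists f0; rewrite e0.
case: (ex_minnP ex) => n /asboolP [f [mf <- Pf]] hmin; exists f; split=> // g mg hg Pg.
have := hmin (size g); rewrite leqNgt hg; move=> /(_ _)/negP; apply=> //.
by apply/asboolP; exists g.
Qed.

Lemma monic_split f : f \is monic -> f = 1 \/ exists g c,
  [/\ g \is monic, (size g < size f)%N & f = g * 'X + c%:P].
Proof.
elim/poly_ind: f => [|g c _]; first by rewrite monicE lead_coef0 eq_sym oner_eq0.
have [->|g0] := eqVneq g 0.
  by rewrite mul0r add0r monicE lead_coefC => /eqP->; left.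
have hs : (size c%:P < size (g * 'X)%R)%N.
  rewrite size_mulX // ltnS (leq_trans (size_polyC_leq1 _)) // lt0n size_poly_eq0 //.
rewrite monicE lead_coefDl // lead_coefMX -monicE => mg; right; exists g, c; split=> //.
by rewrite size_polyDl // size_mulX.
Qed.

(** In a minimal monic relation g(b) b + c = 0 the integer c is nonzero, since otherwise regularity
    would give the shorter relation g(b) = 0. Denominators can therefore be taken in [Z]. *)
Lemma regular_divides b : subring_set S b -> (forall x, subring_set S x -> b * x = 0 -> x = 0) ->
  exists z s, [/\ z != 0, subring_set S s & b * s = kap z].
Proof.
move=> hb breg; have [f [mf ef fmin]] := @min_monic [set 0] b erefl hb.
case: (monic_split mf) => [e1|[g [c [mg sg ef']]]].
  by move: ef; rewrite e1 rmorph1 hornerC => /eqP; rewrite oner_eq0.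
move: ef; rewrite ef' ev_MXaddC /= => e.
exists (- c), (ev g b); split; last 2 first.
- exact: ev_order.
- by rewrite rmorphN; apply/eqP; rewrite -addr_eq0 mulrC; apply/eqP.
rewrite oppr_eq0; apply/eqP => c0; apply: (fmin g) => //=.
by apply: breg; [apply: ev_order|rewrite mulrC -e c0 rmorph0 addr0].
Qed.

(* A nonzero prime of [Z] is maximal, so the constant coefficient of a minimal
   relation for x modulo P is invertible modulo P, and hence so is x. *)
Lemma prime_maximal P z : prime_ideal S P -> z != 0 -> P (kap z) -> maximal_ideal S P.
Proof.
move=> [[hP PS] nP1 Ppr] z0 Pz.
pose m := [set c : Z | P (kap c)].
have hm : maximal_ideal setT m.
  have [_ _ _ h] := hZ; apply: h; last first.
    move=> e; move/eqP: z0; apply; have : m z by exact: Pz.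
    by rewrite e.
  split=> /=.
  - split=> //; split; rewrite /m /=.
    + by rewrite rmorph0; apply: submod0 hP.
    + by move=> a b ha hb; rewrite rmorphD; apply: (submodD hP).
    + by move=> r a _ ha; rewrite rmorphM; apply: (submodZ hP) => //; apply: hSk.
  - by rewrite /m /= rmorph1.
  - by move=> a b _ _; rewrite /m /= rmorphM => /(Ppr _ _ (hSk _) (hSk _)).
have inv c : ~ m c -> exists c', m (c * c' - 1).
  move=> nc; case: hm => -[[m0 mD mZ] _] nT /(_ [set x | exists r y, m y /\ x = r * c + y]) [].
  - split=> //; split=> [|_ _ [r [y [hy ->]]] [r' [y' [hy' ->]]]|a _ _ [r [y [hy ->]]]].
    + by exists 0, 0; rewrite mul0r addr0.
    + by exists (r + r'), (y + y'); split; [apply: mD|ring].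
    + by exists (a * r), (a * y); split; [apply: mZ|ring].
  - by move=> y hy; exists 0, y; rewrite mul0r add0r.
  - by move=> e; case: nc; rewrite -e; exists 1, 0; rewrite mul1r addr0.
  move=> e; have : [set: Z] 1 by []; rewrite -e => -[r [y [hy e1]]]; exists r.
  by rewrite e1 (_ : _ - _ = -1 * y); [apply: mZ|ring].
split=> //; first by move=> e; apply: nP1; rewrite e; apply: subring1.
move=> I hI PI; case: (pselect (exists2 x, I x & ~ P x)) => [[x Ix nPx]|h]; last first.
  by left; rewrite eqEsubset; split=> // x Ix; apply: contrapT => nPx; apply: h; exists x.
right; apply: ideal_full => //; have [hIm IS] := hI; have Sx := IS _ Ix.
have [f [mf Pf fmin]] := min_monic (submod0 hP) Sx.
case: (monic_split mf) => [e1|[g [c [mg sg ef']]]].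
  by move: Pf; rewrite e1 rmorph1 hornerC.
move: Pf; rewrite ef' ev_MXaddC => Pf; have Sg := ev_order g Sx.
have nc : ~ m c.
  rewrite /m /= => hc; apply: (fmin g) => //.
  have : P (ev g x * x).
    by rewrite (_ : _ * _ = (ev g x * x + kap c) - kap c); [apply: (submodB hP)|ring].
  by move=> /Ppr [].
have [c' hc'] := inv _ nc.
have Ic : I (kap c).
  rewrite (_ : kap c = (ev g x * x + kap c) - ev g x * x); last by ring.
  by apply: (submodB hIm); [apply: PI|apply: (submodZ hIm)].
rewrite (_ : 1 = kap c' * kap c - kap (c * c' - 1)); last by rewrite rmorphB rmorphM rmorph1; ring.
by apply: (submodB hIm); [apply: (submodZ hIm)|apply: PI].
Qed.

(** If q met [Z] only in 0, [Z] would embed in the field S / q, which is integral over it; a nonzero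
    nonunit of [Z] would then have an integral inverse and be a unit. *)
Lemma max_contains q : maximal_ideal S q -> exists2 z, z != 0 & q (kap z).
Proof.
move=> hq; apply: contrapT => h.
have q0 z : q (kap z) -> z = 0.
  by move=> hz; apply/eqP; apply: contrapT => /negP z0; apply: h; exists z.
have hqs := max_submod hq.
have [[z [z0 nu]] _ _ _] := hZ.
have [|t St ht] := max_inv hq (hSk z); first by move=> /q0 /eqP; apply/negP.
have [f mf ef] := order_integral St.
(* Modulo q, t is an inverse of z, so z^n f(t) is an integer congruent to the
   leading coefficient of f modulo z. *)
have clear n g : (size g <= n.+1)%N -> exists c d,
    q (kap z ^+ n * ev g t - kap c) /\ c = g`_n + z * d.
  elim: n g => [|n IHn] g; elim/poly_ind: g => [|g b _].
  - exists 0, 0; rewrite coef0; split; last by ring.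
    by rewrite !rmorph0 horner0 mulr0 subrr; apply: submod0 hqs.
  - rewrite size_MXaddC; case: ifP => [/andP[/eqP-> _] _|_].
      exists b, 0; rewrite mul0r add0r coefC; split; last by rewrite /=; ring.
      by rewrite map_polyC hornerC expr0 mul1r subrr; apply: submod0 hqs.
    rewrite ltnS leqn0 size_poly_eq0 => /eqP->.
    exists b, 0; rewrite mul0r add0r coefC; split; last by rewrite /=; ring.
    by rewrite map_polyC hornerC expr0 mul1r subrr; apply: submod0 hqs.
  - exists 0, 0; rewrite coef0; split; last by ring.
    by rewrite !rmorph0 horner0 mulr0 subrr; apply: submod0 hqs.
  move=> hg; have {}hg : (size g <= n.+1)%N.
    move: hg; rewrite size_MXaddC; case: ifP => [/andP[/eqP-> _]|_] //.
    by rewrite size_poly0.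
  have [c [d [hc ec]]] := IHn _ hg.
  exists (c + z * (z ^+ n * b)), (d + z ^+ n * b); split; last first.
    by rewrite coefD coefMX coefC /= addr0 ec; ring.
  rewrite ev_MXaddC (_ : _ - _ = (kap z ^+ n * ev g t) * (kap z * t - 1) +
      (kap z ^+ n * ev g t - kap c)); last first.
    by rewrite rmorphD !rmorphM rmorphXn exprS; ring.
  apply: (submodD hqs) => //; apply: (submodZ hqs) => //.
  apply: subringM; last exact: ev_order.
  by rewrite -rmorphXn; apply: hSk.
have sf : (0 < size f)%N by rewrite lt0n size_poly_eq0 monic_neq0.
have [|c [d [+ ec]]] := clear (size f).-1 f; first by rewrite prednK.
rewrite ef mulr0 sub0r -rmorphN => /q0 /eqP; rewrite oppr_eq0 ec.
rewrite -lead_coefE (monicP mf) addrC addr_eq0 -mulrN1 => /eqP e.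
move/negP: nu; apply; apply/unitrPr; exists (- d).
by rewrite mulrN e mul1r opprK.
Qed.

(** A bad ideal that is maximal among those containing a must be prime, because x y in I with both
    factors outside I gives two larger, hence good, ideals. Containing a nonzero integer, it is
    maximal, and so good after all. *)
Lemma ideal_induction (Good : set K -> Prop) : Good S ->
  (forall q, maximal_ideal S q -> Good q) ->
  (forall a x y, is_ideal S a -> subring_set S x -> subring_set S y -> a (x * y) ->
    Good (adjoin S x a) -> Good (adjoin S y a) -> Good a) ->
  forall a z, is_ideal S a -> z != 0 -> a (kap z) -> Good a.
Proof.
move=> GS Gq GD a z ha z0 az; apply: contrapT => nG.
pose P I := [/\ is_ideal S I, a `<=` I & ~ Good I].
have [s es] := lattice_zspan hS.
have [||I [hI aI nGI] Imax] := @zmodule_max _ _ kap (noethZ hZ) s P.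
- move=> I [[hI IS] _ _]; rewrite -es; split=> //; exact: (submod_zmodule hS hI).
- by exists a; split.
have nI1 : ~ I 1 by move=> /(ideal_full hI) e; apply: nGI; rewrite e.
have Gad x : subring_set S x -> ~ I x -> Good (adjoin S x I).
  move=> Sx nIx; apply: contrapT => nGx; apply: nIx.
  have hIs : submodule S I by case: hI.
  rewrite -(Imax (adjoin S x I)); [exact: adjoin_gen| |exact: adjoin_sub].
  split=> //; first exact: adjoin_ideal.
  by apply: subset_trans aI _; apply: adjoin_sub.
have Ipr : prime_ideal S I.
  split=> // x y Sx Sy Ixy; case: (pselect (I x)) => [|nIx]; first by left.
  case: (pselect (I y)) => [|nIy]; first by right.
  by case: nGI; apply: (GD I x y) => //; apply: Gad.
by apply: nGI; apply: Gq; apply: (prime_maximal Ipr z0); apply: aI.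
Qed.

(** A maximal ideal containing a and x y contains x or y, so the lists for the two enlarged ideals
    can be concatenated. *)
Lemma finite_over a z : is_ideal S a -> z != 0 -> a (kap z) ->
  exists s : seq (set K), (forall i, (i < size s)%N -> maximal_ideal S (nth set0 s i)) /\
    forall q, maximal_ideal S q -> a `<=` q -> exists2 i, (i < size s)%N & nth set0 s i = q.
Proof.
move: a z; apply: ideal_induction.
- exists [::]; split=> // q hq Sq; exfalso.
  by apply: (max_1 hq); apply: Sq; apply: subring1.
- move=> q hq; exists [:: q]; split=> [[|i]//|q' hq' qq']; exists 0%N => //=.
  case: hq => _ _ /(_ q' (max_ideal hq') qq') [//|e].
  by case: hq'; rewrite e.
move=> a x y ha Sx Sy axy [s [hs hs']] [t [ht ht']]; exists (s ++ t).
split=> [i|q hq aq].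
  rewrite size_cat nth_cat; case: (ltnP i (size s)) => [si _|si h]; first exact: hs.
  by apply: ht; rewrite ltn_subLR.
have [_ _ qpr] := max_prime hq; have qs := max_submod hq.
case: (qpr x y Sx Sy (aq _ axy)) => [qx|qy].
  have [|i hi <-] := hs' q hq; first exact: adjoin_min.
  by exists i; rewrite ?size_cat ?nth_cat ?hi // ltn_addr.
have [|i hi <-] := ht' q hq; first exact: adjoin_min.
by exists (size s + i)%N; rewrite ?size_cat ?nth_cat ?ltn_add2l // ltnNge leq_addr /= addKn.
Qed.

End Integrality.

(** * The canonical map to the total quotient ring of a completion *)

Section TotalQuotientsTheory.
Variable A : comPzRingType.

Lemma to_totq_inj : injective (@to_totq A).
Proof. by move=> a b /eqP /totqP /=; rewrite !mulr1. Qed.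

Lemma to_totq_inv (a : A) : regular a -> exists v, to_totq a * v = 1.
Proof.
move=> ha; exists (\pi_(totq A)%qT (Defs.Ratio 1 ha)).
rewrite -[LHS]/(totq_mul _ _) /to_totq totq_mulE.
by apply/eqP/totqP => /=; rewrite !mulr1 !mul1r.
Qed.

Lemma inv_regular (x y : A) : x * y = 1 -> regular x.
Proof. by move=> e a h; rewrite -[a]mul1r -e mulrAC h mul0r. Qed.
End TotalQuotientsTheory.

Section Local.
Variables (Z : idomainType) (Q : fieldType) (iota : {rmorphism Z -> Q}).
Hypotheses (hQ : fraction_field iota) (hZ : dedekind_domain iota).
Variable K : comAlgType Q.
Variable S : subring K.
Hypothesis hS : is_order iota S.
Variable q : set K.
Hypothesis hq : maximal_ideal S q.

Local Notation kap := (kap iota K).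
Local Notation I := [set x : sring S | q (sring_val x)].
Local Notation e a := (to_totq (to_completion I a)).
Local Notation O := (ring_at S q).

Let hqs := max_submod hq.

Lemma sring_in (a : sring S) : subring_set S (sring_val a).
Proof. exact/set_mem/sring_valP. Qed.

Lemma sring_lift x : subring_set S x -> exists a : sring S, sring_val a = x.
Proof. by move=> hx; exists (Sring (mem_set hx)). Qed.

Lemma sring_inj (a b : sring S) : sring_val a = sring_val b -> a = b.
Proof. exact: val_inj. Qed.

Lemma sring_valD (a b : sring S) : sring_val (a + b) = sring_val a + sring_val b.
Proof. by []. Qed.
Lemma sring_valM (a b : sring S) : sring_val (a * b) = sring_val a * sring_val b.
Proof. by []. Qed.
Lemma sring_val1 : sring_val (1 : sring S) = 1. Proof. by []. Qed.
Lemma sring_val0 : sring_val (0 : sring S) = 0. Proof. by []. Qed.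
Lemma local_add_closed : add_closed I.
Proof. by split=> [|a b]; [exact: submod0 hqs|exact: (submodD hqs)]. Qed.

Lemma local_inv s : ~ I s -> exists t, I (s * t - 1).
Proof.
move=> ns; have [t /sring_lift [t' <-] h] := max_inv hq (sring_in s) ns.
by exists t'.
Qed.

(** The existence of s outside q and c with s q^c inside z S. In the induction, a maximal ideal
    other than q contributes to s, the ideal q contributes to the exponent, and the product step
    multiplies the s and adds the c. *)
Lemma local_denom (z : Z) : z != 0 -> exists (s : sring S) c, ~ I s /\
  forall x, idpow I c x -> exists y : sring S, sring_val (s * x) = kap z * sring_val y.
Proof.
move=> z0.
have hSk := order_kap hS.
pose a := [set x | exists y : sring S, x = kap z * sring_val y].
suff [s [c [ns h]]] : exists (s : sring S) c, ~ I s /\ forall x, idpow I c x -> a (sring_val (s * x)).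
  by exists s, c; split.
have ha : is_ideal S a.
  split; last by move=> _ [y ->]; apply: subringM; [apply: hSk|apply: sring_in].
  split; first by exists 0; rewrite sring_val0 mulr0.
    by move=> _ _ [y ->] [y' ->]; exists (y + y'); rewrite sring_valD mulrDr.
  move=> r _ /sring_lift [r' <-] [y ->]; exists (r' * y); rewrite sring_valM mulrCA //.
have az : a (kap z) by exists 1; rewrite sring_val1 mulr1.
pose Good (a : set K) := exists (s : sring S) c, ~ I s /\
  forall x, idpow I c x -> a (sring_val (s * x)).
apply: (ideal_induction (Good := Good) hZ hS _ _ _ ha z0 az); rewrite {a ha az}/Good.
- exists 1, 0%N; split=> [|x _]; first exact: (max_1 hq).
  exact: sring_in.
- move=> q' hq'; case: (pselect (q' = q)) => [->|ne].
    (* At q itself the first power already lies in q, with s = 1. *)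
    exists 1, 1%N; split; first exact: (max_1 hq).
    move=> x; rewrite mul1r /=; apply: (@prodsP _ _ _ I); first exact: local_add_closed.
    by move=> u v hu _; rewrite mulrC; apply: (submodZ hqs) => //; apply: sring_in.
  have [s q's nqs] := max_not_sub hq hq' ne.
  have [s' es] := sring_lift (max_sub hq' q's).
  exists s', 0%N; split=> [|x _]; first by rewrite /= es.
  rewrite sring_valM es mulrC.
  by apply: (submodZ (max_submod hq')) => //; apply: sring_in.
move=> b x y hb Sx Sy bxy [s [c [ns h]]] [s' [c' [ns' h']]].
exists (s * s'), (c + c')%N; split.
  have [_ _ pr] := max_prime hq.
  by move=> /(pr _ _ (sring_in s) (sring_in s')) [].
have [hbs _] := hb.
move=> u; rewrite -idpow_mul.
apply: (@prodsP _ _ _ [set u | b (sring_val (s * s' * u))]).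
  split=> /= [|u1 u2 h1 h2]; first by rewrite mulr0; apply: submod0 hbs.
  by rewrite mulrDr; apply: (submodD hbs).
move=> u1 u2 /h [r [m [hr hm e1]]] /h' [r' [m' [hr' hm' e2]]] /=.
rewrite mulrACA -(sring_valM s) -(sring_valM s') e1 e2.
rewrite (_ : (r * x + m) * (r' * y + m') = (r * r') * (x * y) + (r * x) * m' + (r' * y + m') * m); last by ring.
apply: (submodD hbs); first apply: (submodD hbs).
- by apply: (submodZ hbs) => //; apply: subringM.
- by apply: (submodZ hbs) => //; apply: subringM.
- apply: (submodZ hbs) => //; apply: subringD; [exact: subringM|exact: hb.2].
Qed.

Lemma kap_denom (z : Z) : z != 0 -> exists (b s : sring S) c, [/\ sring_val b = kap z, regular b, ~ I s &
  forall x, idpow I c x -> exists y, s * x = b * y].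
Proof.
move=> z0; have [s [c [ns h]]] := local_denom z0.
have [b eb] := sring_lift (order_kap hS z); exists b, s, c; split=> //.
  move=> x /(congr1 (@sring_val _ _)); rewrite sring_valM eb.
  by move=> /(kap_regular hQ z0) ex; apply: sring_inj.
by move=> x /h [y ey]; exists y; apply: sring_inj; rewrite ey sring_valM eb.
Qed.

(** b divides a nonzero integer, which stays regular in the completion and hence is invertible among
    the fractions. This makes [canon] the graph of a function. *)
Lemma local_regular (b : sring S) : regular b -> exists v, e b * v = 1.
Proof.
move=> hb; have [||z [s [z0 Ss es]]] := @regular_divides _ _ _ hZ _ _ hS (sring_val b).
- exact: sring_in.
- move=> x /sring_lift [x' <-] h.
  by rewrite (_ : x' = 0) //; apply: hb; apply: sring_inj.
have [s' es'] := sring_lift Ss.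
have [d [t [c [ed dreg nt hd]]]] := kap_denom z0.
have [v hv] := to_totq_inv (hat_regular local_inv dreg nt hd).
have ebs : b * s' = d by apply: sring_inj; rewrite sring_valM es' ed.
exists (e s' * v); rewrite mulrA -hv; congr (_ * _).
by rewrite -!rmorphM ebs.
Qed.

Lemma canon_unique x y y' : @Defs.canon _ S q x y -> @Defs.canon _ S q x y' -> y = y'.
Proof.
move=> [a [b [hb ea ey]]] [a' [b' [hb' ea' ey']]].
have [v hv] := local_regular hb; have [v' hv'] := local_regular hb'.
apply: (regularI (regularM (inv_regular hv) (inv_regular hv'))).
have -> : e b * e b' * y = e b' * e a by rewrite mulrAC ey mulrC.
have -> : e b * e b' * y' = e b * e a' by rewrite -mulrA ey'.
rewrite -!rmorphM; congr (to_totq (to_completion _ _)).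
by apply: sring_inj; rewrite !sring_valM -ea -ea'; ring.
Qed.

(** The default value 0 is never taken: [canon_phi] shows that every x has an image. *)
Definition canon_map (x : K) : tot S q := xget 0 [set y | @Defs.canon _ S q x y].

Local Notation phi := canon_map.

Lemma canon_phi x : @Defs.canon _ S q x (phi x).
Proof.
have [z z0 /sring_lift [a ea]] := order_denom hQ hS x.
have [b [s [c [eb breg _ _]]]] := kap_denom z0.
have [v hv] := local_regular breg.
have cx : @Defs.canon _ S q x (v * e a) by exists a, b; rewrite eb ea mulrA hv mul1r.
exact: (@xgetI _ 0 [set y | @Defs.canon _ S q x y] _ cx).
Qed.

Lemma canonP x y : @Defs.canon _ S q x y <-> y = phi x.
Proof. by split=> [h|->]; [apply: canon_unique h (canon_phi x)|apply: canon_phi]. Qed.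

Lemma phi_sring (a : sring S) : phi (sring_val a) = e a.
Proof.
apply/esym/canonP; exists a, 1; split; first exact: regular1.
  by rewrite sring_val1 mul1r.
by rewrite !rmorph1 mul1r.
Qed.

Lemma phi1 : phi 1 = 1.
Proof. by rewrite -sring_val1 phi_sring !rmorph1. Qed.
Lemma phi0 : phi 0 = 0.
Proof. by rewrite -sring_val0 phi_sring !rmorph0. Qed.

Lemma phiD x y : phi (x + y) = phi x + phi y.
Proof.
apply/esym/canonP; have [a [b [hb ea ey]]] := canon_phi x.
have [a' [b' [hb' ea' ey']]] := canon_phi y.
exists (a * b' + a' * b), (b * b'); split; first exact: regularM.
  by rewrite sring_valD !sring_valM -ea -ea'; ring.
by rewrite !rmorphD !rmorphM /= -ey -ey' /=; ring.
Qed.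

Lemma phiM x y : phi (x * y) = phi x * phi y.
Proof.
apply/esym/canonP; have [a [b [hb ea ey]]] := canon_phi x.
have [a' [b' [hb' ea' ey']]] := canon_phi y.
exists (a * a'), (b * b'); split; first exact: regularM.
  by rewrite !sring_valM -ea -ea'; ring.
by rewrite !rmorphM /= -ey -ey' /=; ring.
Qed.

Lemma phiN x : phi (- x) = - phi x.
Proof. by apply/eqP; rewrite -addr_eq0 -phiD addNr phi0. Qed.
Lemma phiB x y : phi (x - y) = phi x - phi y.
Proof. by rewrite phiD phiN. Qed.

Lemma phi_inv x y : x * y = 1 -> phi x * phi y = 1.
Proof. by rewrite -phiM => ->; apply: phi1. Qed.

Fact ring_at_subring : [/\ O 1, forall x y, O x -> O y -> O (x - y) &
  forall x y, O x -> O y -> O (x * y)].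
Proof.
split; first by exists 1; rewrite ?rmorph1.
  by move=> _ _ [a _ <-] [b _ <-]; exists (a - b); rewrite ?rmorphB.
by move=> _ _ [a _ <-] [b _ <-]; exists (a * b); rewrite ?rmorphM.
Qed.
Definition Oq : subring (tot S q) := Subring ring_at_subring.

Lemma phi_Oq x : subring_set S x -> subring_set Oq (phi x).
Proof. by move=> /sring_lift [a <-]; rewrite phi_sring; exists (to_completion I a). Qed.

Lemma Oq_dense r (z : Z) : subring_set Oq r -> z != 0 ->
  exists a r', [/\ subring_set S a, subring_set Oq r' & r = phi a + phi (kap z) * r'].
Proof.
move=> [r0 _ <-] z0; have [b [s [c [eb breg ns h]]]] := kap_denom z0.
have [a [r' ->]] := hat_dense local_inv breg ns h r0.
exists (sring_val a), (to_totq r'); split; [exact: sring_in|by exists r'|].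
by rewrite -eb !phi_sring rmorphD rmorphM.
Qed.

Lemma Oq_divides x r (z : Z) : subring_set S x -> subring_set Oq r -> z != 0 ->
  phi x = phi (kap z) * r ->
  exists s y, [/\ subring_set S s, ~ q s, subring_set S y & s * x = kap z * y].
Proof.
move=> /sring_lift [a <-] [r0 _ <-] z0; have [b [s [c [eb breg ns h]]]] := kap_denom z0.
rewrite -eb !phi_sring -rmorphM => /to_totq_inj /(hat_divides h) [y ey].
exists (sring_val s), (sring_val y); split; [exact: sring_in|exact: ns|exact: sring_in|].
by rewrite -!sring_valM ey.
Qed.

Lemma Oq_unit s : subring_set S s -> ~ q s -> exists2 t, subring_set Oq t & phi s * t = 1.
Proof.
move=> /sring_lift [a <-] ns; have [t ht] := hat_unit local_inv ns.
exists (to_totq t); first by exists t.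
by rewrite phi_sring -rmorphM ht rmorph1.
Qed.

Lemma ideal_atE J : ideal_at S q J = prods Oq [set phi x | x in J].
Proof.
rewrite /ideal_at; congr prods; rewrite eqEsubset.
by split=> y [x Jx h]; exists x => //; [apply/esym/canonP|apply/canonP].
Qed.
End Local.

(** * Localization and weak equivalence *)

Section LocalGlobal.
Variables (Z : idomainType) (Q : fieldType) (iota : {rmorphism Z -> Q}).
Hypotheses (hQ : fraction_field iota) (hZ : dedekind_domain iota).
Variable K : comAlgType Q.
Variable S : subring K.
Hypothesis hS : is_order iota S.
Implicit Types (I J q : set K) (z : Z).

Local Notation kap := (kap iota K).
Local Notation bounded := (bounded iota).

Section AtPrime.
Variable q : set K.
Hypothesis hq : maximal_ideal S q.

Local Notation O := (Oq S q).
Local Notation phi := (canon_map S q).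
Local Notation "J ^~" := (ideal_at S q J) (at level 2, format "J ^~").

Let phiM := phiM hQ hZ hS hq.
Let phiD := phiD hQ hZ hS hq.
Let phiB := phiB hQ hZ hS hq.
Let phi1 := phi1 hQ hZ hS hq.
Let phi0 := phi0 hQ hZ hS hq.
Let phi_Oq := phi_Oq hQ hZ hS hq.
Let hqs := max_submod hq.

Lemma ideal_at_submod J : submodule O J^~.
Proof. by rewrite (ideal_atE hQ hZ hS hq); apply/prods_submodule/subring_submodule. Qed.

Lemma ideal_at_phi J x : J x -> J^~ (phi x).
Proof.
move=> Jx; rewrite (ideal_atE hQ hZ hS hq) -[phi x]mul1r; apply: mem_prods.
  exact: subring1.
by exists x.
Qed.

Lemma ideal_at_min J P : submodule O P -> (forall x, J x -> P (phi x)) -> J^~ `<=` P.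
Proof.
move=> hP h; rewrite (ideal_atE hQ hZ hS hq).
apply: prodsP; first exact: submod_add_closed hP.
by move=> r _ hr [x Jx <-]; apply: (submodZ hP) => //; apply: h.
Qed.

Lemma ideal_at_mono I J : I `<=` J -> I^~ `<=` J^~.
Proof.
by move=> IJ; apply: ideal_at_min => [|x /IJ]; [apply: ideal_at_submod|apply: ideal_at_phi].
Qed.

Lemma ideal_at_self : S^~ = O :> set _.
Proof.
rewrite eqEsubset; split.
  by apply: ideal_at_min => [|x hx]; [apply: subring_submodule|apply: phi_Oq].
move=> x hx; rewrite -[x]mulr1 -phi1; apply: (submodZ (ideal_at_submod S)) => //.
by apply: ideal_at_phi; apply: subring1.
Qed.

Lemma scale_submod (P : set (tot S q)) a : submodule O P -> submodule O [set x | P (a * x)].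
Proof.
move=> hP; split=> /= [|x y hx hy|r x hr hx].
- by rewrite mulr0; apply: submod0 hP.
- by rewrite mulrDr; apply: (submodD hP).
- by rewrite mulrCA; apply: (submodZ hP).
Qed.

Lemma ideal_at_scale I J a : (forall x, I x -> J (a * x)) ->
  forall y, I^~ y -> J^~ (phi a * y).
Proof.
move=> h; apply: (@ideal_at_min I [set y | J^~ (phi a * y)]) => [|x /h Jx /=].
  exact/scale_submod/ideal_at_submod.
by rewrite -phiM; apply: ideal_at_phi.
Qed.

Lemma ideal_at_prods I J x y : I^~ x -> J^~ y -> (prods I J)^~ (x * y).
Proof.
move=> hx; rewrite mulrC; move: hx.
apply: (@ideal_at_min I [set x | J^~ y -> (prods I J)^~ (y * x)]) => [|a Ia /=].
  have hIJ := ideal_at_submod (prods I J).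
  split=> /= [_|u v hu hv hy|r u hr hu hy].
  - by rewrite mulr0; apply: submod0 hIJ.
  - by rewrite mulrDr; apply: (submodD hIJ); [apply: hu|apply: hv].
  - by rewrite mulrCA; apply: (submodZ hIJ) => //; apply: hu.
rewrite mulrC; apply: ideal_at_scale => b Jb; exact: mem_prods.
Qed.

Lemma ideal_at_unit J s : subring_set S s -> ~ q s -> forall y, J^~ (phi s * y) -> J^~ y.
Proof.
move=> Ss ns y h; have [t Ot et] := Oq_unit hQ hZ hS hq Ss ns.
rewrite -[y]mul1r -et mulrAC mulrC; exact: (submodZ (ideal_at_submod J)).
Qed.

Lemma ideal_at_localized J s x : subring_set S s -> ~ q s -> J (s * x) -> J^~ (phi x).
Proof.
move=> Ss ns h; apply: (ideal_at_unit Ss ns); rewrite -phiM; exact: ideal_at_phi.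
Qed.

Lemma ideal_at_dense J y z : submodule S J -> z != 0 -> J^~ y ->
  exists x y', [/\ J x, J^~ y' & y = phi x + phi (kap z) * y'].
Proof.
move=> hJ z0; have hJq := ideal_at_submod J.
rewrite {1}(ideal_atE hQ hZ hS hq); move: y.
apply: (@prodsP _ _ _ [set y | exists x y', [/\ J x, J^~ y' & y = phi x + phi (kap z) * y']]).
  split=> /= [|_ _ [x [y [Jx Jy ->]]] [x' [y' [Jx' Jy' ->]]]].
    exists 0, 0; split; [exact: submod0 hJ|exact: submod0 hJq|].
    by rewrite phi0 mulr0 addr0.
  exists (x + x'), (y + y'); split; [exact: (submodD hJ)|exact: (submodD hJq)|].
  by rewrite phiD; ring.
move=> r _ hr [x Jx <-] /=.
have [a [r' [Sa Or' ->]]] := Oq_dense hQ hZ hS hq hr z0.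
exists (a * x), (r' * phi x); split; first exact: (submodZ hJ).
  by apply: (submodZ hJq) => //; apply: ideal_at_phi.
by rewrite phiM; ring.
Qed.

(** Contraction of the completed ideal gives the localization of J: x is approximated by an element
    of J so closely that the error, up to some s outside q, is a multiple of an integer lying in
    J. *)
Lemma ideal_at_local J x : submodule S J -> bounded S J -> J^~ (phi x) ->
  exists s, [/\ subring_set S s, ~ q s & J (s * x)].
Proof.
move=> hJ [d d0 [Jd hd]] hx; have [d' d'0 hd'] := order_denom hQ hS x.
have hSk := order_kap hS.
(* The factors d and d' make d d' (x - x0) an element of [S] and are cancelled at the end; the
   remaining d, an element of J, carries the quotient y' into J. *)
have z0 : d * d * d' != 0 by rewrite !mulf_neq0.
have [x0 [y [Jx0 Jy ex]]] := ideal_at_dense hJ z0 hx.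
have [|||s [y' [Ss ns Sy' es]]] := @Oq_divides _ _ _ hQ hZ _ _ hS _ hq
    (kap (d * d') * (x - x0)) (phi (kap d') * (phi (kap d) * y)) (d * d * d') _ _ z0.
- rewrite mulrBr rmorphM; apply: subringB.
    by rewrite -mulrA; apply: subringM; first exact: hSk.
  by rewrite [kap d * _]mulrC -mulrA; apply: subringM; [exact: hSk|exact: hd].
- apply: subringM; first exact: phi_Oq.
  by rewrite -ideal_at_self; apply: ideal_at_scale hd _ Jy.
- by rewrite phiM phiB ex !rmorphM !phiM; ring.
exists s; split=> //.
rewrite (_ : s * x = y' * kap d + s * x0); first last.
  apply: (regularI (kap_regular hQ (mulf_neq0 d0 d'0))).
  rewrite mulrDr.
  transitivity (s * (kap (d * d') * (x - x0)) + kap (d * d') * (s * x0)); first by ring.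
  by rewrite es !rmorphM; ring.
by apply: (submodD hJ); apply: (submodZ hJ).
Qed.

(* Up to an element small enough to lie in the localization of (J : I), y comes from
   some a in K; as I is finitely generated, a single s outside q gives s a I <= J. *)
Lemma ideal_at_colon I J y : submodule S I -> bounded S I -> submodule S J -> bounded S J ->
  (forall x, I^~ x -> J^~ (y * x)) -> (colon J I)^~ y.
Proof.
move=> hI bI hJ bJ hy; have [d d0 [Id hd]] := bI.
have [d' ed'] := kap_inv hQ K d0.
have hC := ideal_at_submod (colon J I); have hJq := ideal_at_submod J.
(* The precision is d^2 because y is recovered from d y by dividing by d; the error d j1 left over
   still multiplies I into J, as d I is contained in [S]. *)
have [j0 [j1 [Jj0 Jj1 ej]]] := ideal_at_dense hJ (mulf_neq0 d0 d0) (hy _ (ideal_at_phi Id)).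
have ey : y = phi (d' * j0) + phi (kap d) * j1.
  have := phi_inv hQ hZ hS hq ed' => ed.
  have e1 : phi (kap d) * y = phi (kap d) * (phi (d' * j0) + phi (kap d) * j1).
    by rewrite mulrC ej phiM mulrDr mulrA ed mul1r rmorphM phiM mulrA.
  exact: (regularI (inv_regular ed) e1).
have hsmall : (colon J I)^~ (phi (kap d) * j1).
  apply: ideal_at_scale Jj1 => j Jj x Ix; rewrite mulrAC.
  by apply: (submodZ hJ) => //; apply: hd.
rewrite ey; apply: (submodD hC) => //; set a := d' * j0 in ey *.
have loc x : I x -> exists s, [/\ subring_set S s, ~ q s & J (s * (a * x))].
  move=> Ix; apply: ideal_at_local => //.
  rewrite phiM (_ : phi a = y - phi (kap d) * j1); last by rewrite ey; ring.
  rewrite mulrBl; apply: (submodB hJq); first by apply/hy/ideal_at_phi.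
  rewrite mulrAC -phiM; apply: (submodZ hJq) => //; apply: phi_Oq; exact: hd.
have [t et] := bounded_zspan hQ hZ hS hI bI.
have [s [Ss ns hs]] : exists s, [/\ subring_set S s, ~ q s & forall x, x \in t -> J (s * a * x)].
  have : forall x, x \in t -> I x by move=> x; rewrite et; apply: zspan_mem.
  elim: (t) => [_|x r IHr h]; first by exists 1; split; [apply: subring1|apply: max_1 hq|].
  have [|s [Ss ns hs]] := IHr; first by move=> u hu; apply: h; rewrite inE hu orbT.
  have [s' [Ss' ns' hs']] := loc x (h _ (mem_head _ _)).
  exists (s' * s); split; first exact: subringM.
    by have [_ _ pr] := max_prime hq; move=> /(pr _ _ Ss' Ss) [].
  move=> u; rewrite inE => /orP[/eqP->|/hs hu].
    by rewrite (_ : _ * _ = s * (s' * (a * x))); [apply: (submodZ hJ)|ring].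
  by rewrite (_ : _ * _ = s' * (s * a * u)); [apply: (submodZ hJ)|ring].
apply: (ideal_at_localized Ss ns) => x; rewrite et.
apply: (@zspan_min _ _ kap t [set x | J (s * a * x)]) => //; split; first split=> /=.
- by rewrite mulr0; apply: submod0 hJ.
- by move=> u v hu hv; rewrite mulrDr; apply: (submodD hJ).
- by move=> c u hu /=; rewrite mulrCA; apply: (submodZ hJ) => //; apply: order_kap hS _.
Qed.

(** f is multiplication by y = f(e) / e and its inverse is multiplication by some y'. Both lie in
    completed colon ideals, so 1 = y y' lies in the completion of (J : I)(I : J), and contraction
    returns an s outside q. *)
Lemma isomorphic_at_weq I J : submodule S I -> bounded S I -> submodule S J -> bounded S J ->
  isomorphic_at S q I J ->
  exists s, [/\ subring_set S s, ~ q s & prods (colon J I) (colon I J) s].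
Proof.
move=> hI bI hJ bJ [f [[fIJ _ fsurj] fD fZ]].
have hSk := order_kap hS.
have [e e0 [Ie he]] := bI; have [d d0 [Jd hd]] := bJ.
have [e1 /(phi_inv hQ hZ hS hq) ee] := kap_inv hQ K e0.
have [d1 /(phi_inv hQ hZ hS hq) dd] := kap_inv hQ K d0.
have ie := ideal_at_phi Ie; have jd := ideal_at_phi Jd.
have Oe z : subring_set O (phi (kap z)) by apply: phi_Oq.
pose y := phi e1 * f (phi (kap e)).
have fy x : I^~ x -> f x = y * x.
  move=> hx; apply: (regularI (regularM (inv_regular ee) (inv_regular ee))).
  (* Linearity only holds over the completed ring, and e x is in it; evaluating f at e x e in two
     ways gives e^2 f(x) = e x f(e). *)
  have Oex : subring_set O (phi (kap e) * x).
    by rewrite -ideal_at_self; apply: ideal_at_scale he _ hx.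
  have h1 : f (phi (kap e) * x * phi (kap e)) = phi (kap e) * x * f (phi (kap e)).
    exact: fZ.
  have h2 : f (phi (kap e) * phi (kap e) * x) = phi (kap e) * phi (kap e) * f x.
    by apply: fZ => //; apply: (subringM (Oe e) (Oe e)).
  rewrite -h2 mulrAC h1 /y.
  rewrite (_ : _ * (phi e1 * _ * _) = (phi (kap e) * phi e1) * (phi (kap e) * x * f (phi (kap e)))).
    by rewrite ee mul1r.
  by ring.
have [x1 Ix1 ex1] := fsurj _ jd.
pose y' := x1 * phi d1.
have yy : y * y' = 1 by rewrite /y' mulrA -fy // ex1.
have cy : (colon J I)^~ y by apply: ideal_at_colon => // x hx; rewrite -fy //; apply: fIJ.
have cy' : (colon I J)^~ y'.
  apply: ideal_at_colon => // x /fsurj [x2 Ix2 <-].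
  by rewrite fy // mulrA [y' * _]mulrC yy mul1r.
have := ideal_at_prods cy cy'; rewrite yy -phi1 => /ideal_at_local [||s [Ss ns]].
- exact/prods_submodule/colon_submodule.
- by apply: bounded_prods; apply: bounded_colon.
- by rewrite mulr1 => h; exists s.
Qed.

(** Multiplication by b has the inverse t a, where t is the inverse of the local unit a b. *)
Lemma isomorphic_at_mul I J a b : subring_set S (a * b) -> ~ q (a * b) ->
  colon I J a -> colon J I b -> isomorphic_at S q I J.
Proof.
move=> Sab nab ha hb; have [t Ot et] := Oq_unit hQ hZ hS hq Sab nab.
rewrite phiM in et.
exists (fun x => phi b * x); split; first split=> [x hx|x y _ _ e|y hy].
- exact: ideal_at_scale hb _ hx.
- apply: regularI e; apply: (@inv_regular _ _ (t * phi a)).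
  by rewrite mulrCA mulrC [phi b * _]mulrC.
- exists (t * (phi a * y)); last first.
    by rewrite -[RHS]mul1r -et; ring.
  apply: (submodZ (ideal_at_submod I)) => //; exact: ideal_at_scale ha _ hy.
- by move=> x y _ _; rewrite mulrDr.
- by move=> r x _ _; rewrite mulrCA.
Qed.
End AtPrime.

(** For x in I, the ideal of the r in S with r x in J lies in no maximal ideal, hence contains 1. *)
Lemma ideal_at_sub I J : submodule S J -> bounded S J ->
  (forall q, maximal_ideal S q -> ideal_at S q I `<=` ideal_at S q J) -> I `<=` J.
Proof.
move=> hJ bJ h x Ix.
pose a := [set r | subring_set S r /\ J (r * x)].
have ha : is_ideal S a.
  split; last by move=> r [].
  split=> [|r r' [Sr hr] [Sr' hr']|r' r Sr' [Sr hr]]; rewrite /a /=.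
  - by rewrite mul0r; split; [apply: subring0|apply: submod0 hJ].
  - by rewrite mulrDl; split; [apply: subringD|apply: (submodD hJ)].
  - by rewrite -mulrA; split; [apply: subringM|apply: (submodZ hJ)].
have [|_] := ideal_not_max ha; last by rewrite mul1r.
move=> q hq; have := h q hq _ (ideal_at_phi hq Ix).
move=> /(ideal_at_local hq hJ bJ) [s [Ss ns Js]].
by exists s.
Qed.

Lemma weakly_equivalent_weq I J : submodule S I -> bounded S I -> submodule S J -> bounded S J ->
  weakly_equivalent S I J -> weq I J.
Proof.
move=> hI bI hJ bJ hw.
pose a := [set r | subring_set S r /\ prods (colon J I) (colon I J) r].
have hp : submodule S (prods (colon J I) (colon I J)).
  exact/prods_submodule/colon_submodule.
have ha : is_ideal S a.
  split; last by move=> r [].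
  split=> [|r r' [Sr hr] [Sr' hr']|r' r Sr' [Sr hr]]; split.
  - exact: subring0.
  - exact: submod0 hp.
  - exact: subringD.
  - exact: (submodD hp).
  - exact: subringM.
  - exact: (submodZ hp).
have [|_] := ideal_not_max ha; last by rewrite /weq prodsC.
move=> q hq; have [s [Ss ns hs]] := isomorphic_at_weq hq hI bI hJ bJ (hw q hq).
by exists s.
Qed.

(** As 1 is a sum of products a b and is not in q, some a b is outside q; it lies in [S] because it
    multiplies I into itself. *)
Lemma weq_weakly_equivalent I J : submodule S I -> colon I I = S -> weq I J ->
  weakly_equivalent S I J.
Proof.
move=> hI eI hw q hq; apply: contrapT => nI; apply: (max_1 hq).
move: hw; apply: prodsP; first exact: submod_add_closed (max_submod hq).
move=> a b ha hb; apply: contrapT => nq; apply: nI.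
apply: (isomorphic_at_mul hq _ nq ha hb).
by rewrite -eI => x hx; rewrite -mulrA; apply/ha/hb.
Qed.
End LocalGlobal.

(** * Invertible ideals and descent from T to R *)

Section WeakEquivalenceTheory.
Variable A : comPzRingType.
Implicit Types (R T : subring A) (I J L M N : set A).

Lemma prodsACA I J M N : prods (prods I J) (prods M N) = prods (prods I M) (prods J N).
Proof. by rewrite -!prodsA (prodsA J) (prodsC J) -(prodsA M). Qed.

Lemma prods_subset R M N : submodule R M -> N `<=` R -> prods N M `<=` M.
Proof.
move=> hM NR; apply: prodsP; first exact: submod_add_closed hM.
by move=> r x /NR hr; apply: (submodZ hM).
Qed.

Lemma colon_prods I J L : colon I J `<=` colon (prods I L) (prods J L).
Proof.
move=> a ha x; apply: prods_scale; exact: ha.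
Qed.

Lemma colon_mul I J L a b : colon I J a -> colon J L b -> colon I L (a * b).
Proof. by move=> ha hb x /hb /ha; rewrite mulrA. Qed.

Lemma weq_sym I J : weq I J -> weq J I.
Proof. by rewrite /weq prodsC. Qed.

Lemma colon_trans R I J L : submodule R I -> prods (colon I J) (colon J L) `<=` colon I L.
Proof.
move=> hI; apply: prodsP => [|a b]; last exact: colon_mul.
exact: submod_add_closed (colon_submodule L hI).
Qed.

Lemma weq_trans R I J L : submodule R I -> submodule R L ->
  weq I J -> weq J L -> weq I L.
Proof.
move=> hI hL h1 h2; have : prods (prods (colon I J) (colon J I)) (prods (colon J L) (colon L J)) (1 * 1).
  exact: mem_prods.
rewrite mulr1 prodsACA (prodsC (colon J I)); by apply: prods_mono; [exact: colon_trans hI|exact: colon_trans hL].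
Qed.

Lemma weq_prods I J M : weq I J -> weq (prods I M) (prods J M).
Proof. by apply: prods_mono; apply: colon_prods. Qed.

(** I is contained in (I : J)(J : I) I, hence in (I : J) J. *)
Lemma weq_colon_prods R I J : submodule R I -> submodule R J -> weq I J ->
  prods (colon I J) J = I.
Proof.
move=> hI hJ hw; have evl I' J' : submodule R I' -> prods (colon I' J') J' `<=` I'.
  move=> hI'.
  by apply: prodsP => [|a x ha Jx]; [exact: submod_add_closed hI'|exact: (ha x Jx)].
rewrite eqEsubset; split; first exact: evl.
move=> x Ix; rewrite -[x]mul1r.
have : prods (prods (colon I J) (colon J I)) I (1 * x) by exact: mem_prods.
by rewrite -prodsA; apply: prods_mono => //; apply: evl.
Qed.

(** Carrying the inverse explicitly turns cancellation into associativity of products. *)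
Definition inverse_ideals R L L' :=
  [/\ submodule R L, submodule R L' & prods L L' = R].

Lemma weq_inverse R I J : submodule R I -> submodule R J -> colon J J = R -> weq I J ->
  inverse_ideals R (colon I J) (colon J I).
Proof.
move=> hI hJ eJ hw.
have hC := colon_submodule J hI.
have sub : prods (colon I J) (colon J I) `<=` R.
  by rewrite prodsC -eJ; apply: colon_trans hJ.
split=> //; first exact: colon_submodule.
rewrite eqEsubset; split=> // r hr; rewrite -[r]mulr1.
exact: (submodZ (prods_submodule _ hC)).
Qed.

Section Inverse.
Variables (R : subring A) (L L' : set A).
Hypothesis hL : inverse_ideals R L L'.

Lemma inverse_cancel I : submodule R I -> prods L' (prods L I) = I.
Proof.
by move=> hI; case: hL => _ _ e; rewrite prodsA (prodsC L') e; apply: prods_subring.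
Qed.

(** L is contained in (L I : I) and L' in (I : L I), while 1 lies in L L'. *)
Lemma weq_inverse_prods I : submodule R I -> weq (prods L I) I.
Proof.
move=> hI; case: (hL) => _ _ e.
have : prods L L' 1 by rewrite e; apply: subring1.
apply: prods_mono => a ha x hx; first exact: mem_prods.
by rewrite -[I](inverse_cancel hI); apply: mem_prods.
Qed.

Lemma colon_inverse_prods I : submodule R I -> colon (prods L I) (prods L I) = colon I I.
Proof.
move=> hI; rewrite eqEsubset; split; rewrite (prodsC L); last exact: colon_prods.
rewrite -{3 4}[I](inverse_cancel hI) (prodsC L') (prodsC L); exact: colon_prods.
Qed.

(** L I = I forces L' I = I as well, so both L and L' are inside (I : I) = R; then R = L' L is
    contained in L. *)
Lemma inverse_fix I : submodule R I -> colon I I = R -> prods L I = I -> L = R.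
Proof.
case: (hL) => sL sL' e hI eI eL.
have LR : L `<=` R by rewrite -eI => a La x Ix; rewrite -eL; apply: mem_prods.
have L'R : L' `<=` R.
  by rewrite -eI => a La x; rewrite -{1}eL -{2}[I](inverse_cancel hI); apply: mem_prods.
rewrite eqEsubset; split=> // r hr.
have : prods L' L r by rewrite prodsC e.
exact: (prods_subset sL L'R).
Qed.
End Inverse.

(* In [adjoin R x (prods p M)], locally at [p] the generator is [x], and away from
   [p] the ideal is [M]: this descends the invertible [T]-ideal [M] to [R]. *)
Section Descent.
Variables (R T : subring A) (p M M' : set A) (x y : A).
Hypotheses (RT : R `<=` T) (hp : submodule T p) (pR : p `<=` R).
Hypotheses (hM : submodule T M) (hM' : submodule T M') (MM' : prods M M' = T).
Hypotheses (Mx : M x) (M'y : M' y) (pxy : p (x * y - 1)).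

Local Notation L := (adjoin R x (prods p M)).
Local Notation L' := (adjoin R y (prods p M')).

Lemma descent_sub : L `<=` M.
Proof.
apply: adjoin_min => //; first exact: (submodule_sub RT hM).
by apply: (prods_subset hM) => z /pR /RT.
Qed.

Lemma descent_inverse : inverse_ideals R L L'.
Proof.
have hpR := submodule_sub RT hp.
have hpM := prods_submodule M hpR; have hpM' := prods_submodule M' hpR.
have pT : prods p T `<=` p by rewrite prodsC; exact: (prods_subset hp (fun _ h => h)).
have sL := adjoin_submodule x hpM; have sL' := adjoin_submodule y hpM'.
split=> //; rewrite eqEsubset; split.
  apply: prodsP; first exact: subring_add_closed.
  move=> _ _ [r [m [Rr pm ->]]] [r' [m' [Rr' pm' ->]]].
  have Rxy : subring_set R (x * y).
    by rewrite -[x * y](subrK 1); apply: subringD; [apply: pR|apply: subring1].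
  have p1 : p (m * y).
    apply: pT; rewrite -MM' prodsA; exact: mem_prods.
  have p2 : p (x * m').
    apply: pT; rewrite -MM' (prodsC M) prodsA mulrC; exact: mem_prods.
  have p3 : p (m * m').
    have : prods (prods p p) (prods M M') (m * m').
      by rewrite prodsACA; apply: mem_prods.
    rewrite MM' -prodsA => /(prods_mono (M:=p) (M':=p) (fun _ h => h) pT).
    exact: (prods_subset hpR pR).
  rewrite (_ : _ * _ = r * r' * (x * y) + (r * (x * m') + r' * (m * y) + m * m')); last by ring.
  apply: subringD; first by apply: subringM => //; apply: subringM.
  by apply: pR; apply: (submodD hp) => //; apply: (submodD hp); apply: (submodZ hp) => //; apply: RT.
have hLL' := prods_submodule L' sL.
have pLL' c : p c -> prods L L' (c * c).
  move=> pc; have : prods (prods p p) (prods M M') (c * c * 1).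
    by rewrite MM'; apply: mem_prods; [apply: mem_prods|apply: subring1].
  rewrite mulr1 prodsACA; apply: prods_mono; exact: adjoin_sub.
move=> r Rr; rewrite -[r]mulr1; apply: (submodZ hLL') => //.
pose c := x * y - 1; have pc : p c by exact: pxy.
(* Here c = x y - 1 equals x (c y) - c^2; the first term uses the generator x and c y in p M', and
   c^2 lies in (p M)(p M'). *)
rewrite (_ : 1 = x * y - (x * (c * y) - c * c)); last by rewrite /c; ring.
apply: (submodB hLL'); first by apply: mem_prods; apply: adjoin_gen.
apply: (submodB hLL'); last exact: pLL'.
by apply: mem_prods; [apply: adjoin_gen|apply/adjoin_sub/mem_prods].
Qed.

Lemma descent_up : prods L T = M.
Proof.
rewrite eqEsubset; split.
  by rewrite prodsC -[X in _ `<=` X](prods_subring hM); apply: prods_mono => //; apply: descent_sub.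
have hpM := prods_submodule M (submodule_sub RT hp).
move=> m Mm; rewrite (_ : m = x * (y * m) - (x * y - 1) * m * 1); last by ring.
have hLT : submodule R (prods L T) by apply/prods_submodule/adjoin_submodule.
apply: (submodB hLT); apply: mem_prods; [exact: adjoin_gen| | |exact: subring1].
  by rewrite -MM' prodsC; apply: mem_prods.
by apply/adjoin_sub/mem_prods.
Qed.
End Descent.
End WeakEquivalenceTheory.

Section Approximation.
Variables (Z : idomainType) (Q : fieldType) (iota : {rmorphism Z -> Q}).
Hypothesis hZ : dedekind_domain iota.
Variables (K : comAlgType Q) (T : subring K) (p M M' : set K) (z : Z).
Hypotheses (hT : is_order iota T) (hp : is_ideal T p) (z0 : z != 0) (pz : p (kap iota K z)).
Hypotheses (hM : submodule T M) (hM' : submodule T M') (MM' : prods M M' = T).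

(* Only finitely many maximal ideals of [T] contain [p], so an element of [M]
   outside all the [P M] can be built by avoiding them one after the other. *)
Lemma generator_mod : exists x y, [/\ M x, M' y & p (x * y - 1)].
Proof.
have [s [hs hs']] := finite_over hZ hT hp z0 pz.
have MT a b : M a -> M' b -> subring_set T (a * b).
  by move=> ha hb; rewrite -MM'; apply: mem_prods.
(* The condition that x lies outside P M is tested against the inverse: x y is outside P for some y
   in M'. *)
have [x Mx hx] : exists2 x, M x & forall i, (i < size s)%N ->
    exists2 y, M' y & ~ nth set0 s i (x * y).
  have : forall k, (k <= size s)%N -> exists2 x, M x & forall i, (i < k)%N ->
      exists2 y, M' y & ~ nth set0 s i (x * y).
    elim=> [_|k IHk hk]; first by exists 0 => //; apply: submod0 hM.
    have [x Mx hx] := IHk (ltnW hk); set P := nth set0 s k.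
    case: (pselect (exists2 y, M' y & ~ P (x * y))) => [hy|hy].
      exists x => // i; rewrite ltnS leq_eqVlt => /orP[/eqP->|/hx] //.
    have hP : maximal_ideal T P := hs k hk.
    have Pxy y : M' y -> P (x * y) by move=> ?; apply: contrapT => ?; apply: hy; exists y.
    have [_ _ Ppr] := max_prime hP.
    (* Adding c m to x repairs the defect at P, where c m y is outside P for some y, and changes
       nothing modulo the earlier ideals, all of which contain c. *)
    have [c [Tc nPc hc]] : exists c, [/\ subring_set T c, ~ P c &
        forall i, (i < k)%N -> nth set0 s i c].
      have : forall j, (j <= k)%N -> exists c, [/\ subring_set T c, ~ P c &
          forall i, (i < j)%N -> nth set0 s i c].
        elim=> [_|j IHj hj]; first by exists 1; split; [apply: subring1|apply: max_1 hP|].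
        have [c [Tc nPc hc]] := IHj (ltnW hj).
        have hjs := hs j (ltn_trans hj hk).
        (* The list may repeat ideals, but no earlier one equals P: x already passes the test at
           each of those and fails it at P. *)
        have [|d jd nPd] := max_not_sub hP hjs.
          by move=> e; have [y /Pxy Py] := hx j hj; rewrite e.
        have Td := max_sub hjs jd.
        exists (d * c); split; [exact: subringM|by move=> /(Ppr _ _ Td Tc) []|].
        move=> i; rewrite ltnS leq_eqVlt => /orP[/eqP->|hi].
          by rewrite mulrC; apply: (submodZ (max_submod hjs)).
        apply: (submodZ (max_submod (hs i _))) => //; last exact: hc.
        exact: ltn_trans hi (ltn_trans hj hk).
      by move=> /(_ k (leqnn k)).
    have [m [y [Mm M'y nPmy]]] : exists m y, [/\ M m, M' y & ~ P (m * y)].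
      apply: contrapT => h; apply: (max_1 hP).
      have : subring_set T 1 by apply: subring1.
      rewrite -MM'; apply: prodsP; first exact: submod_add_closed (max_submod hP).
      by move=> a b Ma Mb; apply: contrapT => ?; apply: h; exists a, b.
    exists (x + c * m); first by apply: (submodD hM) => //; apply: (submodZ hM).
    move=> i; rewrite ltnS leq_eqVlt => /orP[/eqP->|hi].
      exists y => // Pe; have : P (c * (m * y)).
        rewrite (_ : c * (m * y) = (x + c * m) * y - x * y); last by ring.
        by apply: (submodB (max_submod hP)) => //; apply: Pxy.
      by move=> /(Ppr _ _ Tc (MT _ _ Mm M'y)) [].
    have [y' M'y' ny'] := hx i hi; exists y' => // Pe; apply: ny'.
    have hi' := max_submod (hs i (ltn_trans hi hk)).
    rewrite (_ : x * y' = (x + c * m) * y' - (m * y') * c); last by ring.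
    by apply: (submodB hi') => //; apply: (submodZ hi'); [apply: MT|apply: hc].
  by move=> /(_ _ (leqnn _)).
(* The ideal x M' + p is proper at no maximal ideal: over those containing p by the choice of x,
   over the others because of p. *)
pose a := [set w | exists y c, [/\ M' y, p c & w = x * y + c]].
have [hps pT] := hp.
have ha : is_ideal T a.
  split; last by move=> _ [y [c [M'y pc ->]]]; apply: subringD; [apply: MT|apply: pT].
  split.
  - exists 0, 0; rewrite mulr0 addr0; split=> //; [exact: submod0 hM'|exact: submod0 hps].
  - move=> _ _ [y [c [My pc ->]]] [y' [c' [My' pc' ->]]]; exists (y + y'), (c + c').
    by split; [apply: (submodD hM')|apply: (submodD hps)|ring].
  - move=> r _ Tr [y [c [My pc ->]]]; exists (r * y), (r * c).
    by split; [apply: (submodZ hM')|apply: (submodZ hps)|ring].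
have [q hq|y [c [M'y pc e]]] := ideal_not_max ha.
  case: (pselect (p `<=` q)) => [/(hs' q hq) [i hi eq]|npq].
    have [y M'y ny] := hx i hi; exists (x * y); last by rewrite -eq.
    by exists y, 0; rewrite addr0; split=> //; apply: submod0 hps.
  apply: contrapT => h; apply: npq => c pc; apply: contrapT => nc; apply: h; exists c => //.
  by exists 0, c; rewrite mulr0 add0r; split=> //; apply: submod0 hM'.
exists x, y; split=> //; rewrite e (_ : _ - _ = - c); last by ring.
exact: (submodN hps).
Qed.
End Approximation.

(** * The multiplicator ring of p and the ideals L_u *)

Section MultiplicatorRing.
Variables (Z : idomainType) (Q : fieldType) (iota : {rmorphism Z -> Q}).
Hypotheses (hQ : fraction_field iota) (hZ : dedekind_domain iota).
Variables (K : comAlgType Q) (R : subring K).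
Hypothesis hR : is_order iota R.
Variable p : set K.
Hypotheses (hp : maximal_ideal R p) (hpinv : ~ invertible R p).
Variable T : subring K.
Hypothesis hT : T = colon p p :> set K.
Implicit Types (I J L : set K) (u : tot R p).

Local Notation kap := (kap iota K).
Local Notation bounded := (bounded iota).
Local Notation phi := (canon_map R p).
Local Notation "J ^~" := (ideal_at R p J) (at level 2, format "J ^~").

Let hps := max_submod hp.
Let pR := max_sub hp.

Lemma sub_multiplicator : R `<=` T.
Proof. by rewrite hT => r Rr x px; apply: (submodZ hps). Qed.
Let RT := sub_multiplicator.

Lemma multiplicator_submod : submodule T p.
Proof.
split; [exact: submod0 hps|exact: (submodD hps)|].
by move=> a x; rewrite hT => ha; apply: ha.
Qed.
Let hpT := multiplicator_submod.

Lemma multiplicator_prods : prods p T = p.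
Proof. by rewrite prodsC; apply: prods_subring. Qed.
Let pT := multiplicator_prods.

Lemma multiplicator_ideal : is_ideal T p.
Proof. by split=> // x /pR /RT. Qed.

(* As p is not invertible, p (R : p) is a proper ideal of R containing p. *)
Lemma colon_multiplicator : colon R p `<=` T.
Proof.
rewrite hT => a ha; have hC := colon_submodule p (subring_submodule (fun _ (h : subring_set R _) => h)).
have hpC : is_ideal R (prods p (colon R p)).
  split; first exact: prods_submodule.
  apply: prodsP; first exact: subring_add_closed.
  by move=> x b px; rewrite mulrC; apply.
have sub : p `<=` prods p (colon R p).
  by move=> x px; rewrite -[x]mulr1; apply: mem_prods => // y /pR; rewrite mul1r.
case: hp => _ _ /(_ _ hpC sub) [e|//] x px.
by rewrite -e mulrC; apply: mem_prods.
Qed.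

Lemma p_bounded : bounded R p.
Proof.
have [z z0 pz] := max_contains hZ hR hp; exists z => //; split=> // x /pR.
by apply: subringM; apply: order_kap hR _.
Qed.

Lemma multiplicator_bounded : bounded R T.
Proof.
have [z z0 pz] := max_contains hZ hR hp; exists z => //; split; first exact/RT/pR.
by move=> x; rewrite hT mulrC => h; apply/pR/h.
Qed.
Let bT := multiplicator_bounded.

Lemma multiplicator_order : is_order iota T.
Proof. exact: (order_overring hQ hZ hR RT bT). Qed.
Let hTo := multiplicator_order.

Lemma fracT J : fractional_ideal iota T J <->
  [/\ submodule T J, submodule R J & bounded R J].
Proof.
split=> [/(fracP hQ hZ hTo) [hJ bJ]|[hJ _ bJ]].
  by split=> //; [apply: (submodule_sub RT hJ)|apply: (bounded_trans hR bT hJ bJ)].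
by apply/(fracP hQ hZ hTo); split=> //; apply: bounded_up bJ.
Qed.

Lemma colon_extension I : submodule R I -> colon I I = R ->
  colon (prods I T) (prods I T) = T.
Proof.
move=> hI eI; rewrite eqEsubset; split; last first.
  move=> t Tt x; rewrite prodsC; apply: prods_scale => y; exact: subringM.
have pIT : prods p (prods I T) `<=` I.
  by rewrite (prodsC I) prodsA pT; apply: (prods_subset hI pR).
move=> a ha; apply: colon_multiplicator => c pc; rewrite -eI => x Ix.
apply: pIT; rewrite (_ : a * c * x = c * (a * (x * 1))); last by ring.
by apply/mem_prods => //; apply/ha/mem_prods => //; apply: subring1.
Qed.

(** The global form of U: by [is_Lu_unit] and [unit_ideal_Lu] these are exactly the ideals L_u for
    units u of T_p. *)
Definition unit_ideal L :=
  [/\ exists L', inverse_ideals R L L', prods L T = T & bounded R L].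

Lemma unit_ideal_submod L : unit_ideal L -> submodule R L.
Proof. by case=> -[L' []]. Qed.

Lemma descent_unit M M' : submodule T M -> submodule T M' -> bounded R M ->
  prods M M' = T -> exists L, [/\ exists L', inverse_ideals R L L', prods L T = M & bounded R L].
Proof.
move=> hM hM' bM eM; have [z z0 pz] := max_contains hZ hR hp.
have [x [y [Mx My pxy]]] := generator_mod hZ hTo multiplicator_ideal z0 pz hM hM' eM.
have hMR := submodule_sub RT hM.
have hpM := prods_submodule M hps.
exists (adjoin R x (prods p M)); split.
- by exists (adjoin R y (prods p M')); apply: (descent_inverse RT).
- exact: (descent_up RT hpT pR hM eM Mx My pxy).
- apply: (bounded_between hR (bounded_prods p_bounded bM) bM) => //.
  + exact: adjoin_sub.
  + exact: (descent_sub RT).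
  + exact: adjoin_submodule.
Qed.

Let sub := ideal_at_submod hQ hZ hR.

Lemma is_Lu_unique u L L' : is_Lu iota u L -> is_Lu iota u L' -> L = L'.
Proof.
have h M M' : is_Lu iota u M -> is_Lu iota u M' -> M `<=` M'.
  move=> [_ eM eMq] [/(fracP hQ hZ hR) [hM' bM'] eM' eMq'].
  apply: (ideal_at_sub hQ hZ hR hM' bM') => q hq.
  case: (pselect (q = p)) => [->|ne]; first by rewrite eM eM'.
  by rewrite eMq // eMq'.
by move=> h1 h2; rewrite eqEsubset; split; apply: h.
Qed.

(** An element s of p outside q is a unit at q and sends both T and R into p, so everything between
    p and T has the same completion as R at q. *)
Lemma ideal_at_away L q : maximal_ideal R q -> q <> p -> submodule R L -> p `<=` L -> L `<=` T ->
  ideal_at R q L = ring_at R q.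
Proof.
move=> hq ne hL pL LT; have [s ps nqs] := max_not_sub hq hp (fun e => ne (esym e)).
have Rs := pR ps; have hLq := sub hq L.
rewrite -[RHS]/(subring_set (Oq R q) : set _) -(ideal_at_self hQ hZ hR hq) eqEsubset; split.
  move=> y hy; apply: (ideal_at_unit hQ hZ hR hq Rs nqs).
  apply: (ideal_at_scale hQ hZ hR hq) hy => x /LT Tx.
  by apply: pR; rewrite mulrC; apply: (submodZ hpT).
move=> y hy; apply: (ideal_at_unit hQ hZ hR hq Rs nqs).
apply: (ideal_at_scale hQ hZ hR hq) hy => x Rx.
by rewrite mulrC; apply: (submodZ hL) => //; apply: pL.
Qed.

Lemma scaled_ring_submod u : submodule (Oq R p) [set u * x | x in ring_at R p].
Proof.
have h := subring_submodule (fun _ (h : subring_set (Oq R p) _) => h).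
split.
- by exists 0; rewrite ?mulr0 //; apply: (submod0 h).
- by move=> _ _ [x hx <-] [y hy <-]; exists (x + y); rewrite ?mulrDr //; apply: (submodD h).
- by move=> r _ hr [x hx <-]; exists (r * x); rewrite 1?mulrCA //; apply: (submodZ h).
Qed.

(** Approximating u and its inverse v modulo p by x and y in T gives x y = 1 modulo p, and the
    descent of the ideal T along x yields L = x R + p. *)
Lemma is_Lu_exists u : Tp_units R p T u -> exists L, is_Lu iota u L /\ unit_ideal L.
Proof.
move=> [Tu [v [Tv uv]]].
have [z0 z00 pz0] := max_contains hZ hR hp.
have hTR := subring_submodule RT.
have phiM := phiM hQ hZ hR hp; have phiB := phiB hQ hZ hR hp; have phi1 := phi1 hQ hZ hR hp.
have hTp := sub hp T; have hpp := sub hp p.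
have TT x y : T^~ x -> T^~ y -> T^~ (x * y).
  move=> hx hy; rewrite -(prods_subring (subring_submodule (fun _ (h : subring_set T _) => h))).
  exact: (ideal_at_prods hQ hZ hR hp).
have Tp x y : T^~ x -> p^~ y -> p^~ (x * y).
  by move=> hx hy; have := ideal_at_prods hQ hZ hR hp hx hy; rewrite (prodsC T) pT.
have small y : T^~ y -> p^~ (phi (kap z0) * y).
  apply: (ideal_at_scale hQ hZ hR hp) => x Tx; rewrite mulrC; exact: (submodZ hpT).
have [x [t [Tx Tt ex]]] := ideal_at_dense hQ hZ hR hp hTR z00 Tu.
have [y [t' [Ty Tt' ey]]] := ideal_at_dense hQ hZ hR hp hTR z00 Tv.
have pxy : p (x * y - 1).
  have : p^~ (phi (x * y - 1)).
    rewrite phiB phiM phi1 -uv.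
    rewrite (_ : _ - _ = - (phi x * (phi (kap z0) * t') + v * (phi (kap z0) * t))); last first.
      by rewrite [in LHS]ex ey; ring.
    apply: (submodN hpp); apply: (submodD hpp); apply: Tp => //; try exact: small.
    exact: (ideal_at_phi hQ hZ hR hp).
  (* Return from the completed p to p: some s outside p has s (x y - 1) in p, and s is invertible
     modulo p. *)
  move=> /(ideal_at_local hQ hZ hR hp hps p_bounded) [s [Rs nps h]].
  have [s' Rs' hs'] := max_inv hp Rs nps.
  rewrite (_ : _ - 1 = s' * (s * (x * y - 1)) - (x * y - 1) * (s * s' - 1)); last by ring.
  apply: (submodB hps); first exact: (submodZ hps).
  by apply: (submodZ hpT) => //; apply: subringB; [apply: subringM|apply: subring1].
have hTT := subring_submodule (fun _ (h : subring_set T _) => h).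
have eTT := prods_subring hTT.
set L := adjoin R x (prods p T).
have hL : unit_ideal L.
  split.
  - by exists (adjoin R y (prods p T)); apply: (descent_inverse RT).
  - exact: (descent_up RT hpT pR hTT eTT Tx Ty pxy).
  - apply: (bounded_between hR (bounded_prods p_bounded bT) bT) => //.
    + exact: adjoin_sub.
    + exact: (descent_sub RT).
    + by apply/adjoin_submodule/prods_submodule.
have sL := unit_ideal_submod hL.
have LT : L `<=` T by apply: (descent_sub RT).
have pL : p `<=` L by rewrite /L pT; apply: adjoin_sub.
exists L; split=> //; split.
- by apply/(fracP hQ hZ hR); split=> //; case: hL.
- have hLp := sub hp L; have hu := scaled_ring_submod u.
  have ring_p w : p^~ w -> ring_at R p w.
    move=> hw; rewrite -[ring_at R p]/(subring_set (Oq R p) : set _) -(ideal_at_self hQ hZ hR hp).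
    by apply: (ideal_at_mono hQ hZ hR hp) hw.
  (* u R_p contains the completed p, so replacing u by its approximation x does not change the ideal
     generated together with p. *)
  have pu w : p^~ w -> [set u * x | x in ring_at R p] w.
    move=> hw; exists (v * w); last by rewrite mulrA uv mul1r.
    by apply/ring_p/Tp.
  rewrite eqEsubset; split.
    apply: (ideal_at_min hQ hZ hR hp) => // w; rewrite /L pT => -[r [m [Rr pm ->]]].
    rewrite (phiD hQ hZ hR hp) phiM; apply: (submodD hu); last first.
      exact/pu/(ideal_at_phi hQ hZ hR hp).
    apply: (submodZ hu); first exact: (phi_Oq hQ hZ hR hp).
    rewrite (_ : phi x = u * 1 - phi (kap z0) * t); last by rewrite ex; ring.
    apply: (submodB hu); last exact/pu/small.
    by exists 1 => //; apply: (subring1 (Oq R p)).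
  move=> _ [w hw <-]; rewrite mulrC; apply: (submodZ hLp) => //.
  rewrite ex; apply: (submodD hLp).
    by apply: (ideal_at_phi hQ hZ hR hp); apply/adjoin_gen/prods_submodule.
  by apply: (ideal_at_mono hQ hZ hR hp pL); apply: small.
- by move=> q hq ne; apply: ideal_at_away.
Qed.

Lemma is_Lu_unit u L : Tp_units R p T u -> is_Lu iota u L -> unit_ideal L.
Proof. by move=> /is_Lu_exists [L' [hL' uL']] hL; rewrite (is_Lu_unique hL hL'). Qed.

(** The inclusion of p holds because p = p T = p L T = L p is contained in L. *)
Lemma unit_ideal_sub L L' : prods L T = T -> inverse_ideals R L L' -> [/\ L `<=` T, L' `<=` T & p `<=` L].
Proof.
move=> eL [hL hL' e].
have LT : L `<=` T.
  by move=> x Lx; rewrite -eL -[x]mulr1; apply: mem_prods => //; apply: subring1.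
have eL' : prods L' T = T.
  by rewrite -{1}eL prodsA (prodsC L') e; apply: prods_subring; apply: subring_submodule.
split=> //.
  by move=> x Lx; rewrite -eL' -[x]mulr1; apply: mem_prods => //; apply: subring1.
by rewrite -{1}pT -eL (prodsC L) prodsA pT; apply: (prods_subset hL pR).
Qed.

(** L L' = R is not inside p, so some a b is a unit at p; then a generates L there, and its inverse
    is b up to that unit. *)
Lemma unit_ideal_Lu L : unit_ideal L -> exists2 u, Tp_units R p T u & is_Lu iota u L.
Proof.
move=> hL; have [[L' iL] eL bL] := hL; have [sL sL' e] := iL.
have [LT L'T pL] := unit_ideal_sub eL iL.
have phiM := phiM hQ hZ hR hp.
have [a [b [La Lb nab]]] : exists a b, [/\ L a, L' b & ~ p (a * b)].
  apply: contrapT => h; apply: (max_1 hp); have : subring_set R 1 by apply: subring1.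
  rewrite -e; apply: prodsP; first exact: submod_add_closed hps.
  by move=> a b La Lb; apply: contrapT => nab; apply: h; exists a, b.
have RLL x y : L x -> L' y -> subring_set R (x * y).
  by move=> Lx Ly; rewrite -e; apply: mem_prods.
have [t Ot et] := Oq_unit hQ hZ hR hp (RLL _ _ La Lb) nab.
have uv : phi a * (t * phi b) = 1 by rewrite -et phiM; ring.
exists (phi a).
  split; first by apply: (ideal_at_phi hQ hZ hR hp); apply: LT.
  exists (t * phi b); split=> //; apply: (submodZ (sub hp T)) => //.
  by apply: (ideal_at_phi hQ hZ hR hp); apply: L'T.
split; first by apply/(fracP hQ hZ hR).
  rewrite eqEsubset; split.
    apply: (ideal_at_min hQ hZ hR hp); first exact: scaled_ring_submod.
    move=> x Lx; exists (t * phi (x * b)).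
      apply: (@subringM _ (Oq R p)) => //; apply: (phi_Oq hQ hZ hR hp); exact: RLL.
    by rewrite -[RHS]mul1r -uv phiM; ring.
  move=> _ [w hw <-]; rewrite mulrC; apply: (submodZ (sub hp L)) => //.
  exact: (ideal_at_phi hQ hZ hR hp).
by move=> q hq ne; apply: ideal_at_away.
Qed.

Lemma is_Lu_mul u u' L L' : is_Lu iota u L -> is_Lu iota u' L' ->
  is_Lu iota (u * u') (prods L L').
Proof.
move=> [/(fracP hQ hZ hR) [sL bL] eL hL] [/(fracP hQ hZ hR) [sL' bL'] eL' hL'].
have O1 q : ring_at R q 1 by apply: (subring1 (Oq R q)).
have OM q x y : ring_at R q x -> ring_at R q y -> ring_at R q (x * y).
  exact: (@subringM _ (Oq R q)).
split.
- by apply/(fracP hQ hZ hR); split; [apply: prods_submodule|apply: bounded_prods].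
- rewrite eqEsubset; split.
    apply: (ideal_at_min hQ hZ hR hp); first exact: scaled_ring_submod.
    apply: (@prodsP _ _ _ [set x | [set u * u' * w | w in ring_at R p] (phi x)]).
      have h := submod_add_closed (scaled_ring_submod (u * u')).
      split=> /= [|x y]; first by rewrite (phi0 hQ hZ hR hp); case: h.
      by rewrite (phiD hQ hZ hR hp); case: h => _; apply.
    move=> x y /(ideal_at_phi hQ hZ hR hp); rewrite eL => -[w Ow ew].
    move=> /(ideal_at_phi hQ hZ hR hp); rewrite eL' => -[w' Ow' ew'].
    exists (w * w'); first exact: OM.
    by rewrite (phiM hQ hZ hR hp) -ew -ew'; ring.
  move=> _ [w Ow <-]; rewrite -mulrA; apply: (ideal_at_prods hQ hZ hR hp).
    by rewrite eL; exists 1; rewrite ?mulr1.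
  by rewrite eL'; exists w.
- move=> q hq ne; rewrite eqEsubset; split.
    apply: (ideal_at_min hQ hZ hR hq).
      exact: (subring_submodule (fun _ (h : subring_set (Oq R q) _) => h)).
    apply: (@prodsP _ _ _ [set x | ring_at R q (canon_map R q x)]).
      split=> /= [|x y]; first by rewrite (phi0 hQ hZ hR hq); apply: (subring0 (Oq R q)).
      by rewrite (phiD hQ hZ hR hq); apply: (@subringD _ (Oq R q)).
    move=> x y /(ideal_at_phi hQ hZ hR hq); rewrite hL // => hx.
    move=> /(ideal_at_phi hQ hZ hR hq); rewrite hL' // => hy.
    by rewrite /= (phiM hQ hZ hR hq); apply: OM.
  move=> w Ow; rewrite -[w]mul1r; apply: (ideal_at_prods hQ hZ hR hq).
    by rewrite hL.
  by rewrite hL'.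
Qed.

Lemma is_Lu1 : is_Lu iota (1 : tot R p) R.
Proof.
have hRR := subring_submodule (fun _ (h : subring_set R _) => h).
split.
- by apply/(fracP hQ hZ hR); split=> //; apply: bounded_self.
- rewrite (ideal_at_self hQ hZ hR hp) eqEsubset; split=> [x hx|_ [x hx <-]].
    by exists x; rewrite ?mul1r.
  by rewrite mul1r.
- by move=> q hq _; rewrite (ideal_at_self hQ hZ hR hq).
Qed.

Lemma is_Lu_trivial u : is_Lu iota u R -> Rp_units R p u.
Proof.
move=> [_ + _]; rewrite (ideal_at_self hQ hZ hR hp) => e.
have O1 : ring_at R p 1 by apply: (subring1 (Oq R p)).
split.
  have : [set u * x | x in ring_at R p] u by exists 1; rewrite ?mulr1.
  by rewrite -e.
have : subring_set (Oq R p) 1 by [].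
by rewrite e => -[v Ov uv]; exists v.
Qed.

Lemma Rp_unitsM u v : Rp_units R p u -> Rp_units R p v -> Rp_units R p (u * v).
Proof.
have OM x y : ring_at R p x -> ring_at R p y -> ring_at R p (x * y).
  exact: (@subringM _ (Oq R p)).
move=> [Ou [u' [Ou' eu]]] [Ov [v' [Ov' ev]]]; split; first exact: OM.
by exists (u' * v'); split; [apply: OM|rewrite mulrACA eu ev mulr1].
Qed.

Lemma Rp_units1 : Rp_units R p 1.
Proof.
have O1 : ring_at R p 1 by apply: (subring1 (Oq R p)).
by split=> //; exists 1; rewrite mulr1.
Qed.

Lemma Rp_units_inv u : Rp_units R p u -> exists2 v, Rp_units R p v & u * v = 1.
Proof.
by move=> [Ou [v [Ov e]]]; exists v => //; split=> //; exists u; rewrite mulrC.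
Qed.

Lemma U_class_self u : U_class u u.
Proof. by exists 1; [apply: Rp_units1|rewrite mulr1]. Qed.

Lemma U_class_unit u : Rp_units R p u -> U_class u = Rp_units R p.
Proof.
move=> hu; have [v hv uv] := Rp_units_inv hu.
rewrite eqEsubset; split=> [_ [w hw <-]|w hw]; first exact: Rp_unitsM.
by exists (v * w); [apply: Rp_unitsM|rewrite mulrA uv mul1r].
Qed.

Lemma is_Lu_class u u' L : U_class u = U_class u' -> is_Lu iota u L -> is_Lu iota u' L.
Proof.
move=> e; have := U_class_self u; rewrite e => -[v hv <-] [hL eL hL'].
split=> //; rewrite eL.
have OM x y : ring_at R p x -> ring_at R p y -> ring_at R p (x * y).
  exact: (@subringM _ (Oq R p)).
have [w hw vw] := Rp_units_inv hv.
rewrite eqEsubset; split=> _ [x hx <-].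
  by exists (v * x); [apply: OM => //; case: hv|rewrite mulrA].
exists (w * x); first by apply: OM => //; case: hw.
by rewrite mulrA -[u' * v * w]mulrA vw mulr1.
Qed.

Lemma U_mul_class u u' : U_mul (U_class u) (U_class u') = U_class (u * u').
Proof.
rewrite eqEsubset; split=> [_ [_ [_ [[v hv <-] [v' hv' <-] ->]]]|_ [v hv <-]].
  by exists (v * v'); [apply: Rp_unitsM|rewrite mulrACA].
exists u, (u' * v); split; [exact: U_class_self|by exists v|by rewrite mulrA].
Qed.

Lemma Tp_unitsM u u' : Tp_units R p T u -> Tp_units R p T u' -> Tp_units R p T (u * u').
Proof.
have TT x y : T^~ x -> T^~ y -> T^~ (x * y).
  move=> hx hy; rewrite -(prods_subring (subring_submodule (fun _ (h : subring_set T _) => h))).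
  exact: (ideal_at_prods hQ hZ hR hp).
move=> [Tu [v [Tv uv]]] [Tu' [v' [Tv' uv']]]; split; first exact: TT.
by exists (v * v'); split; [apply: TT|rewrite mulrACA uv uv' mulr1].
Qed.

Lemma Tp_units1 : Tp_units R p T 1.
Proof.
have T1 : T^~ 1.
  rewrite -(phi1 hQ hZ hR hp); apply: (ideal_at_phi hQ hZ hR hp); exact: subring1.
by split=> //; exists 1; rewrite mulr1.
Qed.
End MultiplicatorRing.

(** * The sets V_i *)

Section Vsets.
Variables (Z : idomainType) (Q : fieldType) (iota : {rmorphism Z -> Q}).
Hypotheses (hQ : fraction_field iota) (hZ : dedekind_domain iota).
Variables (K : comAlgType Q) (R : subring K).
Hypothesis hR : is_order iota R.
Variable p : set K.
Hypothesis hp : maximal_ideal R p.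
Variable T : subring K.
Hypothesis hT : T = colon p p :> set K.
Variable J : set K.
Hypotheses (hJ : submodule T J) (bJ : bounded iota R J) (eJ : colon J J = T).
Implicit Types (I L : set K) (W : set (set K)).

Let hps := max_submod hp.
Let pR := max_sub hp.
Let RT : R `<=` T := sub_multiplicator hp hT.
Let hpT : submodule T p := multiplicator_submod hp hT.
Let pT : prods p T = p := multiplicator_prods hp hT.
Let hJR : submodule R J := submodule_sub RT hJ.

Local Notation pJ := (prods p J).

Lemma pJ_submod : submodule T pJ. Proof. exact: prods_submodule. Qed.
Let hN := pJ_submod.
Let hNR : submodule R pJ := submodule_sub RT hN.

Lemma pJ_sub : pJ `<=` J. Proof. exact: (prods_subset hJR pR). Qed.

Lemma pJ_bounded : bounded iota R pJ.
Proof. by apply: bounded_prods => //; apply: (p_bounded hZ hR hp). Qed.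

Lemma resmul_pJ a x : subring_set T a -> J x ->
  resmul pJ (rescl p a) (rescl pJ x) = rescl pJ (a * x).
Proof.
move=> Ta Jx; apply: (resmul_rescl hNR); first exact: submod0 hps.
  by move=> n; apply: (submodZ hN).
move=> m y pm; rewrite /rescl /= => h; apply: mem_prods => //.
by rewrite (_ : y = (y - x) + x); [apply: (submodD hJ) => //; apply: pJ_sub|ring].
Qed.

(** [resspan] writes the coset from J / pJ as the left factor, whereas [resmul_pJ] has it on the
    right. *)
Lemma resmulC (N C D : set K) : resmul N C D = resmul N D C.
Proof.
by rewrite eqEsubset; split=> z [x [y [hx hy h]]]; exists y, x; rewrite mulrC.
Qed.

Lemma resq_mem I x : submodule R I -> pJ `<=` I -> resq I pJ (rescl pJ x) <-> I x.
Proof.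
move=> hI pI; apply: (resq_rescl hNR) => //; first exact: submod_add_closed hI.
exact: (submodN hI).
Qed.

Lemma resq_sub I I' : submodule R I' -> pJ `<=` I' -> resq I pJ `<=` resq I' pJ -> I `<=` I'.
Proof.
by move=> hI' pI' h x Ix; apply/(resq_mem x hI' pI')/h; exists x.
Qed.

Lemma resq_inj I I' : submodule R I -> submodule R I' -> pJ `<=` I -> pJ `<=` I' ->
  resq I pJ = resq I' pJ -> I = I'.
Proof.
by move=> hI hI' pI pI' e; rewrite eqEsubset; split; apply: resq_sub => //; rewrite e.
Qed.

Lemma is_lift_unique W I I' : is_lift iota R p J W I -> is_lift iota R p J W I' -> I = I'.
Proof.
by move=> [[hI _] pI _ eW] [[hI' _] pI' _ eW']; apply: resq_inj; rewrite -?eW -?eW'.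
Qed.

Lemma resspan_resq I : submodule R I -> pJ `<=` I -> I `<=` J ->
  resspan pJ (resq I pJ) (resq T p) = resq (prods I T) pJ.
Proof.
move=> hI pI IJ; rewrite eqEsubset; split.
  move=> _ [s [hs ->]]; elim: s hs => [|e s IHs] hs.
    rewrite big_nil; exists 0 => //; exact: submod0 (prods_submodule T hI).
  have [|y hy ey] := IHs; first by move=> e' he'; apply: hs; rewrite inE he' orbT.
  rewrite big_cons; have [[x Ix <-] [a Ta <-]] := hs e (mem_head _ _).
  rewrite -ey resmulC resmul_pJ ?(resadd_rescl hNR) //; last exact: IJ.
  exists (a * x + y) => //; apply: (submodD (prods_submodule T hI)) => //.
  by rewrite mulrC; apply: mem_prods.
move=> _ [_ [s [hs ->]] <-]; exists [seq (rescl pJ e.1, rescl p e.2) | e <- s]; split.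
  move=> _ /mapP [e /hs [Ie Te] ->]; split; [by exists e.1|by exists e.2].
rewrite big_map; elim: s hs => [|e s IHs] hs; first by rewrite !big_nil.
have [Ie Te] := hs e (mem_head _ _).
rewrite !big_cons /= resmulC resmul_pJ ?(resadd_rescl hNR) //; last exact: IJ.
rewrite -IHs ?(resadd_rescl hNR) 1?mulrC //.
by move=> e' he'; apply: hs; rewrite inE he' orbT.
Qed.

(** The condition on A only tests multipliers from T. Once I T = J, a multiplier of I also
    multiplies J and lies in (J : J) = T, so the test sees all of (I : I). *)
Lemma Vset_resq I : submodule R I -> pJ `<=` I -> I `<=` J ->
  Vset R p T J (resq I pJ) <-> prods I T = J /\ colon I I = R.
Proof.
move=> hI pI IJ; have mem x := resq_mem x hI pI.
have hIT : submodule R (prods I T) by apply: prods_submodule.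
have IIT : I `<=` prods I T.
  by move=> x Ix; rewrite -[x]mulr1; apply: mem_prods => //; apply: subring1.
have span : resspan pJ (resq I pJ) (resq T p) = resq J pJ <-> prods I T = J.
  rewrite resspan_resq //; split=> [|-> //]; apply: resq_inj => //.
    exact: subset_trans pI IIT.
  exact: pJ_sub.
have stab a : subring_set T a ->
    (forall C, resq I pJ C -> resq I pJ (resmul pJ (rescl p a) C)) <-> colon I I a.
  move=> Ta; split=> [h x Ix|h _ [x Ix <-]].
    by apply/mem; rewrite -resmul_pJ //; [apply: h; apply/mem|apply: IJ].
  by rewrite resmul_pJ //; [apply/mem/h|apply: IJ].
have Rmem a : resq R p (rescl p a) <-> subring_set R a.
  apply: (resq_rescl hps) => //; first exact: subring_add_closed.
  by move=> y; apply: subringN.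
have colT : prods I T = J -> colon I I `<=` T.
  by move=> eI a ha; rewrite -eJ -eI; apply: colon_prods.
split=> [[_ hstab /span eI]|[eI eII]].
  split=> //; rewrite eqEsubset; split=> [a ha|r Rr x Ix]; last exact: (submodZ hI).
  have Ta := colT eI _ ha; apply/Rmem; rewrite -hstab; split; first by exists a.
  exact/stab.
split; last exact/span.
  split.
  - by move=> _ [x Ix <-]; exists x => //; apply: IJ.
  - by apply/mem; apply: submod0 hI.
  - by move=> _ _ [x Ix <-] [y Iy <-]; rewrite (resadd_rescl hNR); apply/mem/(submodD hI).
  - move=> _ _ [r Rr <-] [x Ix <-]; rewrite resmul_pJ; [|exact: RT|exact: IJ].
    by apply/mem/(submodZ hI).
rewrite eqEsubset; split.
  by move=> _ [[a Ta <-] /(stab a Ta)]; rewrite eII => Ra; exists a.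
move=> _ [r Rr <-]; split; first by exists r => //; apply: RT.
by apply/stab; [apply: RT|rewrite eII].
Qed.

Definition over_ideal I := [/\ submodule R I, bounded iota R I, prods I T = J & colon I I = R].

(** The lower bound is p J = p I T = I p, contained in I. *)
Lemma over_ideal_between I : over_ideal I -> pJ `<=` I /\ I `<=` J.
Proof.
move=> [hI bI eI _]; split.
  by rewrite -eI (prodsC I) prodsA pT; apply: (prods_subset hI pR).
by move=> x Ix; rewrite -eI -[x]mulr1; apply: mem_prods => //; apply: subring1.
Qed.

Lemma over_ideal_Vset I : over_ideal I -> Vset R p T J (resq I pJ).
Proof.
move=> h; have [pI IJ] := over_ideal_between h; case: h => hI bI eI eII.
exact/Vset_resq.
Qed.

Lemma over_ideal_lift I : over_ideal I -> is_lift iota R p J (resq I pJ) I.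
Proof.
move=> h; have [pI IJ] := over_ideal_between h; case: h => hI bI eI eII.
by split=> //; apply/(fracP hQ hZ hR).
Qed.

Lemma Vset_lift W : Vset R p T J W -> exists2 I, over_ideal I & W = resq I pJ.
Proof.
move=> VW; have [[WJ W0 WD WZ] _ _] := VW.
pose I := [set x | J x /\ W (rescl pJ x)].
have hI : submodule R I.
  split=> [|x y [Jx Wx] [Jy Wy]|r x Rr [Jx Wx]]; split => //=.
  - exact: submod0 hJ.
  - exact: (submodD hJ).
  - by rewrite -(resadd_rescl hNR); apply: WD.
  - exact: (submodZ hJR).
  - by rewrite -resmul_pJ //; [apply: WZ => //; exists r|apply: RT].
have pI : pJ `<=` I.
  move=> x px; split; first exact: pJ_sub.
  rewrite (_ : rescl pJ x = rescl pJ 0) //; apply/(rescl_eqP hNR).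
  by rewrite sub0r; apply: (submodN hNR).
have IJ : I `<=` J by move=> x [].
have eW : W = resq I pJ.
  rewrite eqEsubset; split=> [C WC|_ [x [_ Wx] <-] //].
  by have [x Jx eC] := WJ _ WC; exists x => //; split=> //; rewrite eC.
exists I => //; move: VW; rewrite eW => /(Vset_resq hI pI IJ) [eI eII]; split=> //.
exact: (bounded_between hR pJ_bounded bJ).
Qed.

Lemma unit_over L I : unit_ideal iota R T L -> over_ideal I -> over_ideal (prods L I).
Proof.
move=> [[L' iL] eL bL] [hI bI eI eII]; have [hL _ _] := iL; split.
- exact: prods_submodule.
- exact: bounded_prods.
- rewrite -prodsA eI -[J](prods_subring hJ) prodsA eL //.
- by rewrite (colon_inverse_prods iL hI).
Qed.

(** L = (I' : I) and its inverse (I : I') both multiply J into itself, so they lie in T; then T = L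
    L' T is contained in L T. *)
Lemma over_ideal_weq I I' : over_ideal I -> over_ideal I' -> weq I' I ->
  exists2 L, unit_ideal iota R T L & prods L I = I'.
Proof.
move=> [hI bI eI eII] [hI' bI' eI' eII'] hw.
have eL := weq_colon_prods hI' hI hw.
have iL := weq_inverse hI' hI eII hw.
exists (colon I' I) => //; split; first by exists (colon I I').
  have h I1 I2 : prods I1 T = J -> prods I2 T = J -> colon I1 I2 `<=` T.
    by move=> e1 e2; rewrite -eJ -{1}e1 -e2; apply: colon_prods.
  have LT := h _ _ eI' eI; have L'T := h _ _ eI eI'.
  have hTT := subring_submodule (fun _ (h : subring_set T _) => h).
  rewrite eqEsubset; split; first exact: (prods_subset hTT LT).
  have [_ _ e] := iL; rewrite -{1}(prods_subring (subring_submodule RT)) -e -prodsA.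
  by apply: prods_mono => //; apply: (prods_subset hTT L'T).
exact: bounded_colon.
Qed.
End Vsets.

(** * Weak classes and the action *)

Section WeakClasses.
Variables (Z : idomainType) (Q : fieldType) (iota : {rmorphism Z -> Q}).
Hypotheses (hQ : fraction_field iota) (hZ : dedekind_domain iota).
Variables (K : comAlgType Q) (S : subring K).
Hypothesis hS : is_order iota S.
Implicit Types I J : set K.

Lemma weq_refl I : weq I I.
Proof. by rewrite /weq -[1]mulr1; apply: mem_prods => x; rewrite mul1r. Qed.

Lemma weak_class_refl I : submodule S I -> bounded iota S I -> colon I I = S ->
  weak_class iota S I I.
Proof.
move=> hI bI eI; split; first exact/(fracP hQ hZ hS).
by apply: (weq_weakly_equivalent hQ hZ hS) => //; apply: weq_refl.
Qed.

Lemma weak_class_weq I J : submodule S I -> bounded iota S I ->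
  weak_class iota S I J -> weq I J.
Proof.
move=> hI bI [/(fracP hQ hZ hS) [hJ bJ]].
exact: (weakly_equivalent_weq hQ hZ hS hI bI hJ bJ).
Qed.

Lemma weak_class_eq I J : submodule S I -> bounded iota S I -> colon I I = S ->
  submodule S J -> bounded iota S J -> colon J J = S ->
  weq I J <-> weak_class iota S I = weak_class iota S J.
Proof.
move=> hI bI eI hJ bJ eJ; split=> [hw|e]; last first.
  by apply: weak_class_weq => //; rewrite e; apply: weak_class_refl.
have incl I1 I2 : submodule S I1 -> bounded iota S I1 -> colon I2 I2 = S -> submodule S I2 ->
    weq I1 I2 -> weak_class iota S I1 `<=` weak_class iota S I2.
  move=> h1 b1 e2 h2 hw' L hL; have h := weak_class_weq h1 b1 hL.
  case: hL => /[dup] fL /(fracP hQ hZ hS) [sL bL] _; split=> //.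
  apply: (weq_weakly_equivalent hQ hZ hS) => //.
  exact: (weq_trans h2 sL (weq_sym hw') h).
by rewrite eqEsubset; split; apply: incl => //; apply: weq_sym.
Qed.
End WeakClasses.

(** * The action of U on lifts, and its freeness *)

Section IdealAction.
Variables (Z : idomainType) (Q : fieldType) (iota : {rmorphism Z -> Q}).
Hypotheses (hQ : fraction_field iota) (hZ : dedekind_domain iota).
Variables (K : comAlgType Q) (R : subring K).
Hypothesis hR : is_order iota R.
Variable p : set K.
Hypothesis hp : maximal_ideal R p.
Variable T : subring K.
Hypothesis hT : T = colon p p :> set K.
Variable J : set K.
Hypotheses (hJ : submodule T J) (bJ : bounded iota R J) (eJ : colon J J = T).
Implicit Types (I L : set K) (W : set (set K)).

Local Notation pJ := (prods p J).
Local Notation good := (over_ideal iota R T J).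

(** The union over all choices of u, L and I, which avoids choosing representatives; [ideal_actE]
    shows that every choice gives the same set. *)
Definition ideal_act (g : set (tot R p)) W : set (set K) :=
  [set C | exists u L I, [/\ Tp_units R p T u, g = U_class u, is_Lu iota u L,
     is_lift iota R p J W I & resq (prods L I) pJ C]].

Lemma ideal_actE u L W I : Tp_units R p T u -> is_Lu iota u L -> is_lift iota R p J W I ->
  ideal_act (U_class u) W = resq (prods L I) pJ.
Proof.
move=> Tu hL hI; rewrite eqEsubset; split=> [C|C hC]; last by exists u, L, I.
move=> [u' [L' [I' [_ e hL' hI' hC]]]].
have hLu := is_Lu_class (esym e) hL'.
rewrite (is_Lu_unique hQ hZ hR hL hLu).
by rewrite (is_lift_unique hp hT hI hI').
Qed.

Lemma ideal_act_good u L I : Tp_units R p T u -> is_Lu iota u L -> good I ->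
  good (prods L I) /\ ideal_act (U_class u) (resq I pJ) = resq (prods L I) pJ.
Proof.
move=> Tu hL hI; split; last exact/ideal_actE/(over_ideal_lift hQ hZ hR hp hT).
exact: (unit_over hJ (is_Lu_unit hQ hZ hR hp hT Tu hL) hI).
Qed.

Lemma good_resq_inj I I' : good I -> good I' -> resq I pJ = resq I' pJ -> I = I'.
Proof.
move=> hI hI'; have [pI _] := over_ideal_between hp hT hI.
have [pI' _] := over_ideal_between hp hT hI'.
by case: hI hI' => [sI _ _ _] [sI' _ _ _]; apply: (resq_inj hp hT).
Qed.

Lemma ideal_act1 I : good I -> ideal_act (Rp_units R p) (resq I pJ) = resq I pJ.
Proof.
move=> hI; rewrite -(U_class_unit (Rp_units1 R p)).
have T1 := Tp_units1 hQ hZ hR hp T.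
have [_ ->] := ideal_act_good T1 (is_Lu1 hQ hZ hR hp) hI.
by case: hI => [hI _ _ _]; rewrite prods_subring.
Qed.

Lemma ideal_act_free :
  free_action (U_group R p T) U_mul (Rp_units R p) (Vset R p T J) ideal_act.
Proof.
have lift := Vset_lift hZ hR hp hT hJ bJ eJ.
have Lu := is_Lu_exists hQ hZ hR hp hT.
split.
- move=> _ W [u Tu <-] /lift [I hI ->]; have [L [hL _]] := Lu u Tu.
  have [hLI ->] := ideal_act_good Tu hL hI.
  exact: (over_ideal_Vset hp hT hJ eJ hLI).
- by move=> W /lift [I hI ->]; apply: ideal_act1.
- move=> _ _ W [u Tu <-] [u' Tu' <-] /lift [I hI ->].
  have [L [hL uL]] := Lu u Tu; have [L' [hL' uL']] := Lu u' Tu'.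
  have [hLI' ->] := ideal_act_good Tu' hL' hI.
  have [_ ->] := ideal_act_good Tu hL hLI'.
  have Tuu := Tp_unitsM hQ hZ hR hp Tu Tu'.
  have hLL := is_Lu_mul hQ hZ hR hp hL hL'.
  rewrite U_mul_class; have [_ ->] := ideal_act_good Tuu hLL hI.
  by rewrite prodsA.
move=> _ W [u Tu <-] /lift [I hI ->]; have [L [hL uL]] := Lu u Tu.
have [hLI ->] := ideal_act_good Tu hL hI.
move=> /(good_resq_inj hLI hI) eLI.
have [[L' iL] _ _] := uL; case: hI => [hI bI eI eII].
have eL := inverse_fix iL hI eII eLI.
by apply: U_class_unit; apply: (is_Lu_trivial hQ hZ hR hp); rewrite -eL.
Qed.
End IdealAction.
Arguments ideal_act {Z Q} iota {K} R p T J.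

Theorem mainTheorem1
  (Z : idomainType) (Q : fieldType) (iota : {rmorphism Z -> Q})
  (hQ : fraction_field iota) (hZ : dedekind_domain iota)
  (K : comAlgType Q) (hK : etale_algebra K)
  (R : subring K) (hR : is_order iota R)
  (p : set K) (hp : maximal_ideal R p) (hpinv : ~ invertible R p)
  (hpuniq : forall q, maximal_ideal R q -> ~ invertible R q -> q = p)
  (T : subring K) (hT : T = colon p p :> set K)
  (n : nat) (J : 'I_n -> set K)
  (hJ : forall i, fractional_ideal iota T (J i) /\ colon (J i) (J i) = T)
  (hJrep : set_bij setT (Wbar iota T) (fun i => weak_class iota T (J i))) :
  [/\ forall u, Tp_units R p T u -> exists! L, is_Lu iota u L,
      forall i W, Vset R p T (J i) W -> exists! I, is_lift iota R p (J i) W I &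
      exists act : 'I_n -> set (tot R p) -> set (set K) -> set (set K),
        [/\ forall i u L W I,
              Tp_units R p T u -> is_Lu iota u L ->
              Vset R p T (J i) W -> is_lift iota R p (J i) W I ->
              act i (U_class u) W = resq (prods L I) (prods p (J i)),
            forall i,
              free_action (U_group R p T) U_mul (Rp_units R p)
                (Vset R p T (J i)) (act i) &
            exists f : set (set K) -> 'I_n * set (set (set K)),
              set_bij (Wbar iota R)
                [set iO | orbits (U_group R p T) (Vset R p T (J iO.1))
                            (act iO.1) iO.2] f]].
Proof.
have RT := sub_multiplicator hp hT.
have hTo := multiplicator_order hQ hZ hR hp hT.
have JT i : submodule T (J i) by have [/(fracT hQ hZ hR hp hT) [h _ _] _] := hJ i.
have bJ i : bounded iota R (J i) by have [/(fracT hQ hZ hR hp hT) [_ _ h] _] := hJ i.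
have JR i : submodule R (J i) := submodule_sub RT (JT i).
have eJ i : colon (J i) (J i) = T by have [] := hJ i.
have bT := multiplicator_bounded hZ hR hp hT.
pose good i I := over_ideal iota R T (J i) I.
have lift i W : Vset R p T (J i) W -> exists2 I, good i I & W = resq I (prods p (J i)).
  exact: (Vset_lift hZ hR hp hT (JT i) (bJ i) (eJ i)).
split.
- move=> u Tu; have [L [hL _]] := is_Lu_exists hQ hZ hR hp hT Tu.
  by exists L; split=> // L'; apply: (is_Lu_unique hQ hZ hR hL).
- move=> i W /lift [I hI ->].
  have hlI := over_ideal_lift hQ hZ hR hp hT hI.
  by exists I; split=> // I'; apply: (is_lift_unique hp hT hlI).
exists (fun i => ideal_act iota R p T (J i)); split.
- move=> i u L W I Tu hL _ hI; exact: (ideal_actE hQ hZ hR hp hT Tu hL hI).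
- by move=> i; apply: (ideal_act_free hQ hZ hR hp hT (JT i) (bJ i) (eJ i)).
set act := fun i : 'I_n => ideal_act iota R p T (J i).
have index I : submodule R I -> bounded iota R I -> colon I I = R ->
    exists i, weq (J i) (prods I T).
  move=> hI bI eI; have [_ _ surj] := hJrep.
  have hIT : submodule T (prods I T) by rewrite prodsC; apply/prods_submodule/subring_submodule.
  have bIT : bounded iota T (prods I T) by apply: (bounded_up RT); apply: bounded_prods.
  have eIT := colon_extension hp hpinv hT hI eI.
  have [|i _ ei] := surj (weak_class iota T (prods I T)).
    by exists (prods I T); split=> //; apply/(fracP hQ hZ hTo).
  exists i; apply/(weak_class_eq hQ hZ hTo) => //; exact: (bounded_up RT).
(* The class of R T supplies an index, needed as the value of f outside [Wbar]. *)
have [i0 _] : exists i, weq (J i) (prods R T).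
  have hRR := subring_submodule (fun _ (h : subring_set R _) => h).
  apply: index => //; first exact: bounded_self.
  rewrite eqEsubset; split=> [a /(_ 1 (subring1 R))|a Ra x]; first by rewrite mulr1.
  exact: subringM.
pose orbit i I : set (set (set K)) := [set act i g (resq I (prods p (J i))) | g in U_group R p T].
(* The bijection is first a relation, through some representative I with I T = J_i, and becomes a
   function by choice. *)
pose rel C (io : 'I_n * set (set (set K))) :=
  exists I, [/\ good io.1 I, C = weak_class iota R I & io.2 = orbit io.1 I].
have goodE i I : good i I -> [/\ submodule R I, bounded iota R I & colon I I = R] by case.
have goodW i I I' : good i I -> good i I' ->
    weak_class iota R I = weak_class iota R I' <-> weq I I'.
  move=> /goodE [sI bI eI] /goodE [sI' bI' eI'].
  by rewrite (weak_class_eq hQ hZ hR).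
have rel_ex C : Wbar iota R C -> exists io, rel C io.
  move=> [I [/(fracP hQ hZ hR) [sI bI] eI ->]].
  have [i hw] := index I sI bI eI; have eIT := colon_extension hp hpinv hT sI eI.
  have sIT : submodule T (prods I T) by rewrite prodsC; apply/prods_submodule/subring_submodule.
  have [_ _ eM] := weq_inverse (JT i) sIT eIT hw.
  (* The invertible T-ideal (J_i : I T) descends to L, and L I is a representative of the same class
     with (L I) T = (J_i : I T) I T = J_i. *)
  have [|||L [[L' iL] eL bL]] := descent_unit hQ hZ hR hp hT _ _ _ eM.
  - exact: colon_submodule.
  - exact: colon_submodule.
  - apply: (bounded_colon (JR i) (bJ i)); exact: bounded_prods.
  have sL : submodule R L by case: iL.
  have sLI := prods_submodule I sL.
  have bLI := bounded_prods bL bI.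
  have eLI := colon_inverse_prods iL sI; rewrite eI in eLI.
  exists (i, orbit i (prods L I)), (prods L I); split=> //=.
  + split=> //; rewrite -prodsA -[in LHS](prods_subring sIT) prodsA eL.
    exact: (weq_colon_prods (JT i) sIT hw).
  + apply/(weak_class_eq hQ hZ hR) => //; apply/weq_sym; exact: (weq_inverse_prods iL).
have actE i u L I : Tp_units R p T u -> is_Lu iota u L -> good i I ->
    good i (prods L I) /\
    act i (U_class u) (resq I (prods p (J i))) = resq (prods L I) (prods p (J i)).
  exact: (ideal_act_good hQ hZ hR hp hT (JT i)).
have rel_weq i i' I I' : good i I -> good i' I' -> weq I I' -> i = i'.
  move=> gI gI' hw; have [_ inj _] := hJrep.
  have [_ _ eI _] := gI; have [_ _ eI' _] := gI'.
  (* Multiplying by T turns an equivalence of I and I' into one of J_i and J_i', which represent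
     distinct classes unless i = i'. *)
  apply: inj; rewrite ?inE //; apply/(weak_class_eq hQ hZ hTo) => //; try exact: (bounded_up RT).
  by rewrite -eI -eI'; apply: weq_prods.
have orbitE i I I' : good i I -> good i I' -> orbit i I (resq I' (prods p (J i))) <-> weq I I'.
  move=> gI gI'; split=> [[_ [u Tu <-]]|/weq_sym hw].
    have [L [hL uL]] := is_Lu_exists hQ hZ hR hp hT Tu.
    have [gLI ->] := actE i _ _ _ Tu hL gI.
    move=> /(good_resq_inj hp hT gLI gI') <-; apply: weq_sym.
    by have [[L' iL] _ _] := uL; apply: (weq_inverse_prods iL); case: (goodE _ _ gI).
  have [L uL eL] := over_ideal_weq hp hT (eJ i) gI gI' hw.
  have [u Tu hL] := unit_ideal_Lu hQ hZ hR hp hT uL.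
  exists (U_class u); first by exists u.
  by have [_ ->] := actE i _ _ _ Tu hL gI; rewrite eL.
have orbit_sub i I I' : good i I -> good i I' -> weq I I' -> orbit i I' `<=` orbit i I.
  move=> gI gI' hw _ [_ [u Tu <-] <-].
  have [L [hL uL]] := is_Lu_exists hQ hZ hR hp hT Tu.
  have [gLI ->] := actE i _ _ _ Tu hL gI'.
  have [sI _ _] := goodE _ _ gI; have [sI' _ _] := goodE _ _ gI'; have [sLI _ _] := goodE _ _ gLI.
  apply/orbitE => //; apply: (weq_trans sI sLI hw); apply: weq_sym.
  by have [[L' iL] _ _] := uL; apply: (weq_inverse_prods iL).
have [f hf] : exists f, forall C, Wbar iota R C -> rel C (f C).
  have /choice [f hf] : forall C, exists io, Wbar iota R C -> rel C io.
    move=> C; case: (pselect (Wbar iota R C)) => [/rel_ex [io h]|nC]; first by exists io.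
    by exists (i0, set0).
  by exists f.
exists f; split.
- move=> C /hf [I [gI _ eO]]; rewrite /= eO.
  exists (resq I (prods p (J (f C).1))) => //.
  exact: (over_ideal_Vset hp hT (JT _) (eJ _) gI).
- move=> C C'; rewrite !inE => /hf [I [gI eC eO]] /hf [I' [gI' eC' eO']] ef.
  rewrite -ef in gI' eO'; rewrite eC eC'; apply/(goodW _ _ _ gI gI')/(orbitE _ _ _ gI gI').
  rewrite -eO eO'; apply/orbitE => //; exact: weq_refl.
move=> [i O] /= [W VW eO]; have [I gI eW] := lift i W VW.
have [sI bI eI] := goodE _ _ gI.
exists (weak_class iota R I); first by exists I; split=> //; apply/(fracP hQ hZ hR).
have [|I' [gI' eC eO']] := hf (weak_class iota R I).
  by exists I; split=> //; apply/(fracP hQ hZ hR).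
have [sI' bI' eI'] := goodE _ _ gI'.
have hw : weq I I' by apply/(weak_class_eq hQ hZ hR).
have ei := rel_weq _ _ _ _ gI gI' hw.
move: gI' eO'; case: (f _) ei => [i' O'] /= <- gI' ->.
congr pair; rewrite -eO eW -/(orbit i I) eqEsubset.
by split; apply: orbit_sub => //; apply: weq_sym.
Qed.
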